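(* Let $A\in M_\ell(\mathbb C)^g$, and let $h\in\mathbb C^{\nu\times\nu}\langle x,x^*\rangle$ be a hereditary matrix polynomial of degree $d$. Then $h(X)\succeq0$ for all $X\in\mathcal D_A$ if and only if $$h=\sum_k^{\rm finite}h_k^*h_k+\sum_j^{\rm finite}f_j^*L_Af_j$$ for some matrix-valued analytic polynomials $h_k\in\mathbb C^{\ell\times\nu}\langle x\rangle_{d+1}$ and $f_j\in\mathbb C^{\ell\times\nu}\langle x\rangle_d$. Moreover, if $\mathcal D_A$ is bounded, then the pure sum of squares term $\sum_kh_k^*h_k$ may be omitted, provided the $f_j$ are allowed to have degree $\le d+1$.
   Context: $x=(x_1,\dots,x_g)$ are freely noncommuting variables with formal adjoints $x^*=(x_1^*,\dots,x_g^* )$. $\mathbb C^{a\times b}\langle x,x^*\rangle$ is the space of $a\times b$ matrix polynomials in $x,x^*$, with the natural involution; $\mathbb C^{a\times b}\langle x\rangle_m$ denotes the analytic ones (only $x$, no $x^*$) of degree at most $m$. A polynomial is hereditary if it is a finite linear combination (with matrix coefficients) of terms $v^*w$ with $v,w$ words in $x$, i.e. all $x^*$ variables appear to the left of all $x$ variables. Evaluation at $X\in M_n(\mathbb C)^g$ substitutes $X_j$ for $x_j$ and $X_j^*$ for $x_j^*$ and uses the Kronecker product with the coefficients. $L_A(x)=I_\ell+\sum_jA_jx_j+\sum_jA_j^*x_j^*$, and $\mathcal D_A=(\mathcal D_A(n))_n$ with $\mathcal D_A(n)=\{X\in M_n(\mathbb C)^g:L_A(X)=I+\sum A_j\otimes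 X_j+\sum A_j^*\otimes X_j^*\succeq0\}$. It is bounded if there is $N$ with $\|X\|\le N$ for all $n$ and all $X\in\mathcal D_A(n)$. *)

(* Defs.v *)
From HB Require Import structures.
From mathcomp Require Import all_boot all_order all_algebra.
From mathcomp Require Import finmap monalg.
From mathcomp Require Import complex mxtens.
From mathcomp Require Import boolp classical_sets reals.

Set Implicit Arguments.
Unset Strict Implicit.
Unset Printing Implicit Defensive.

Import Order.TTheory GRing.Theory Num.Theory.

Local Open Scope ring_scope.
Local Open Scope sesquilinear_scope.

(* Letters: [inl j] is the variable x_j and [inr j] its formal adjoint x_j^*. *)
Notation letter g := ('I_g + 'I_g)%type.
Notation word g := {fmonom (letter g)}.

(* C<x, x^*>: an a x b matrix polynomial is a matrix with entries in it. *)
Notation ncpoly C g := {malg C[word g]}.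

Section Words.
Variable g : nat.

Definition star_letter (a : letter g) : letter g :=
  match a with inl j => inr j | inr j => inl j end.

Definition star_word (w : word g) : word g :=
  FMonom (rev [seq star_letter a | a <- w]).

Definition analytic_word (w : word g) : Prop :=
  forall a, a \in (w : seq (letter g)) -> exists j, a = inl j.

Definition hereditary_word (u : word g) : Prop :=
  exists v w : word g,
    [/\ analytic_word v, analytic_word w & u = mmul (star_word v) w].

End Words.

Section MatrixPolynomials.
Variables (C : numClosedFieldType) (g : nat).
Local Notation P := (ncpoly C g).

Definition var (a : letter g) : P := << fmu a >>.

Definition star (p : P) : P :=
  \sum_(w <- msupp p) << (p@_w)^* *g star_word w >>.

Definition starmx a b (p : 'M[P]_(a, b)) : 'M[P]_(b, a) :=
  \matrix_(i, j) star (p j i).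

Definition coefmx a b (p : 'M[P]_(a, b)) (w : word g) : 'M[C]_(a, b) :=
  map_mx (mcoeff w) p.

Definition suppmx a b (p : 'M[P]_(a, b)) : {fset word g} :=
  (\big[fsetU/fset0]_(ij : 'I_a * 'I_b) msupp (p ij.1 ij.2))%fset.

(* Total degree: both x_j and x_j^* have degree 1. The degree of 0 is 0. *)
Definition degmx a b (p : 'M[P]_(a, b)) : nat := \max_(w <- suppmx p) fdeg w.

Definition analytic a b (p : 'M[P]_(a, b)) : Prop :=
  forall w, w \in suppmx p -> analytic_word w.

Definition hereditary a b (p : 'M[P]_(a, b)) : Prop :=
  forall w, w \in suppmx p -> hereditary_word w.

Definition analytic_deg_le a b (m : nat) (p : 'M[P]_(a, b)) : Prop :=
  analytic p /\ (degmx p <= m)%N.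

Section Evaluation.
Variables (n : nat) (X : 'I_g -> 'M[C]_n).

Definition eval_letter (a : letter g) : 'M[C]_n :=
  match a with inl j => X j | inr j => (X j)^t* end.

Definition eval_word (w : word g) : 'M[C]_n :=
  \big[mulmx/1%:M]_(a <- (w : seq (letter g))) eval_letter a.

Definition evalmx a b (p : 'M[P]_(a, b)) : 'M[C]_(a * n, b * n) :=
  \sum_(w <- suppmx p) coefmx p w *t eval_word w.

End Evaluation.

Definition scalevar a b (A : 'M[C]_(a, b)) (x : letter g) : 'M[P]_(a, b) :=
  map_mx (fun c => c *: var x) A.

Definition pencil l (A : 'I_g -> 'M[C]_l) : 'M[P]_l :=
  1%:M + \sum_j scalevar (A j) (inl j) + \sum_j scalevar ((A j)^t*) (inr j).

End MatrixPolynomials.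

Section Spectrahedra.
Variable C : numClosedFieldType.

(* On C, [0 <= z] means that z is real and nonnegative. *)
Definition psdmx n (M : 'M[C]_n) : Prop :=
  M^t* = M /\ forall v : 'cV[C]_n, 0 <= (v^t* *m M *m v) ord0 ord0.

Definition free_spectrahedron g l (A : 'I_g -> 'M[C]_l) (n : nat) :
    set ('I_g -> 'M[C]_n) :=
  [set X | psdmx (evalmx X (pencil A))].

Definition psd_on_spectrahedron g l nu (A : 'I_g -> 'M[C]_l)
    (h : 'M[ncpoly C g]_nu) : Prop :=
  forall (n : nat) (X : 'I_g -> 'M[C]_n),
    free_spectrahedron A X -> psdmx (evalmx X h).

End Spectrahedra.

Section Boundedness.
Variable R : realType.
Local Notation C := (complex R).

Definition euclnorm n (v : 'cV[C]_n) : R :=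
  Num.sqrt (\sum_i ComplexField.Normc.normc (v i ord0) ^+ 2).

Definition opnorm m n (M : 'M[C]_(m, n)) : R :=
  sup [set euclnorm (M *m v) | v in [set v : 'cV[C]_n | euclnorm v <= 1]].

(* The maximum is equivalent, up to factors depending only on g, to the norm of
   the X_j assembled into a row or a column, so boundedness does not depend on
   this choice. *)
Definition tuplenorm g n (X : 'I_g -> 'M[C]_n) : R :=
  \big[Num.max/0]_(j < g) opnorm (X j).

Definition free_bounded g l (A : 'I_g -> 'M[C]_l) : Prop :=
  exists N : R, forall (n : nat) (X : 'I_g -> 'M[C]_n),
    free_spectrahedron A X -> tuplenorm X <= N.

End Boundedness.

(* Main.v *)
Require Import Defs.
From HB Require Import structures.
From mathcomp Require Import all_boot all_order all_algebra.
From mathcomp Require Import finmap monalg.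
From mathcomp Require Import complex mxtens.
From mathcomp Require Import boolp classical_sets reals.
From mathcomp Require Import topology normedtype derive spectral ring lra.

Set Implicit Arguments.
Unset Strict Implicit.
Unset Printing Implicit Defensive.

Import Order.TTheory GRing.Theory Num.Theory.
Import numFieldNormedType.Exports.

Local Open Scope ring_scope.
Local Open Scope sesquilinear_scope.

(** A hereditary matrix polynomial whose words [v^* w] satisfy |v|, |w| <= D is
    the same thing as a matrix H indexed by pairs (word of length at most D,
    column): it is [W^* H W], where W is the column of all monomials
    ([hpoly], [hereditary_hpoly]).  In these terms the square of an analytic
    polynomial with coefficient matrix Q is [Q^* Q], and [f^* L_A f] is an
    explicit quadratic expression in the coefficients of f ([pencil_form],
    [pencil_hpoly]); its linear terms shift words by one letter, which is why
    degree d for f goes with degree d + 1 for the squares.  The certificates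
    thus form a convex cone in a finite-dimensional space of matrices, and a
    polynomial that is nonnegative on the spectrahedron is shown to lie in it by
    duality.

    Duality.  [sesqui_farkas]: either the target is in the cone, or some linear
    functional is nonnegative on the cone and negative on the target, provided
    some functional is uniformly positive on the generators of the cone.  That
    functional makes the distance to the target coercive in the generators, so
    the distance is attained, and the residual at a minimum separates.  A
    uniformly positive functional Y0 exists ([strictly_positive_exists]): give
    the monomial w the weight [eta ^ |w|], with eta so small that the cross
    terms of the pencil are absorbed by the diagonal ones.

    The GNS construction.  If a functional Y is nonnegative on the cone, adding a
    small multiple of Y0 makes it positive definite.  The analytic polynomials of
    degree at most d then form a Hilbert space, on which X_j is multiplication
    by x_j into degree d + 1 followed by the orthogonal projection back.  The
    nonnegativity of Y on all [f^* L_A f] says exactly that X lies in D_A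
    ([gns_in_spectrahedron]).  A word of length at most d applied to a constant
    never leaves the space, so h(X) evaluated at the constants is the value of Y
    on h ([gns_eval]); hence Y is nonnegative on h, and no functional separates
    h from the cone ([certificate_of_positive], [psd_certificate]).  The same
    duality shows that the matrix H of h is Hermitian ([psd_hermitian]).

    Bounded spectrahedra.  Here tuples of scalars suffice: by the same duality,
    either [sum_k V_k^* L_A V_k = 1] for some constant matrices V_k, or D_A
    contains a ray of scalar tuples ([bounded_identity]).  In the first case
    [p^* p = sum_k p^* V_k^* L_A V_k p] removes the squares without raising
    the degree ([absorb_squares]). *)

(** * Minima of coercive functions of a complex matrix *)

Section Minimum.
Variable R : realType.
Local Notation C := (complex R).

(** Outside the box the values exceed [f 0], so a minimum over the compact box is
    a global one. *)
Lemma coercive_min n (f : 'rV[R]_n -> R) (K : R) :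
  continuous f -> 0 <= K ->
  (forall x, f x <= f 0 -> forall i, `|x ord0 i| <= K) ->
  exists x0, forall x, f x0 <= f x.
Proof.
move=> fC K0 fK.
pose box : set 'rV[R]_n :=
  [set v | forall i, `[- K, K]%classic (v ord0 i)]%classic.
have boxE x : box x <-> forall i, `|x ord0 i| <= K.
  by split=> xb i; have := xb i; rewrite /= in_itv /= ler_norml.
have box0 : box 0 by apply/boxE => i; rewrite mxE normr0.
have [|||c cbox cmin] := @EVT_min_rV R n f box.
- by exists 0.
- exact: (@rV_compact R n (fun=> `[- K, K]%classic) (fun=> @segment_compact R _ _)).
- exact: continuous_subspaceT.
exists c => x.
have [xbox|xbox] := pselect (box x); first by apply: cmin; rewrite inE.
apply: le_trans (cmin 0 _) _; first by rewrite inE.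
by case: (leP (f 0) (f x)) => // /ltW /fK /boxE.
Qed.

Lemma continuous_ext n (f g : 'rV[R]_n -> R) :
  f =1 g -> continuous g -> continuous f.
Proof. by move=> /funext ->. Qed.

(** Continuity is tested on real and imaginary parts, so that everything is a
    real function on a real coordinate space, where boxes are compact. *)
Definition ccont n (F : 'rV[R]_n -> C) :=
  continuous (fun x => complex.Re (F x)) /\ continuous (fun x => complex.Im (F x)).

Lemma ccont_cst n (c : C) : ccont (fun _ : 'rV[R]_n => c).
Proof. by split=> x; exact: cst_continuous. Qed.

Lemma ccontD n (F G : 'rV[R]_n -> C) :
  ccont F -> ccont G -> ccont (fun x => F x + G x).
Proof.
move=> [F1 F2] [G1 G2]; split.
  apply: (@continuous_ext _ _ (fun x => complex.Re (F x) + complex.Re (G x))).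
    by move=> y; case: (F y) (G y) => ? ? [].
  by move=> x; exact: continuousD (F1 x) (G1 x).
apply: (@continuous_ext _ _ (fun x => complex.Im (F x) + complex.Im (G x))).
  by move=> y; case: (F y) (G y) => ? ? [].
by move=> x; exact: continuousD (F2 x) (G2 x).
Qed.

Lemma ccontM n (F G : 'rV[R]_n -> C) :
  ccont F -> ccont G -> ccont (fun x => F x * G x).
Proof.
move=> [F1 F2] [G1 G2]; split.
  apply: (@continuous_ext _ _ (fun x => complex.Re (F x) * complex.Re (G x)
                                      - complex.Im (F x) * complex.Im (G x))).
    by move=> y; case: (F y) (G y) => ? ? [].
  by move=> x; exact: (continuousB (continuousM (F1 x) (G1 x))
                                   (continuousM (F2 x) (G2 x))).
apply: (@continuous_ext _ _ (fun x => complex.Re (F x) * complex.Im (G x)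
                                    + complex.Im (F x) * complex.Re (G x))).
  by move=> y; case: (F y) (G y) => ? ? [].
by move=> x; exact: (continuousD (continuousM (F1 x) (G2 x))
                                 (continuousM (F2 x) (G1 x))).
Qed.

Lemma ccont_conj n (F : 'rV[R]_n -> C) : ccont F -> ccont (fun x => (F x)^*).
Proof.
move=> [F1 F2]; split.
  by apply: continuous_ext F1 => y; case: (F y).
apply: (@continuous_ext _ _ (fun x => - complex.Im (F x))).
  by move=> y; case: (F y).
by move=> x; exact: continuousN (F2 x).
Qed.

Lemma ccont_ext n (F G : 'rV[R]_n -> C) : F =1 G -> ccont G -> ccont F.
Proof. by move=> /funext ->. Qed.

Lemma ccont_sum n (I : Type) (r : seq I) (F : I -> 'rV[R]_n -> C) :
  (forall i, ccont (F i)) -> ccont (fun x => \sum_(i <- r) F i x).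
Proof.
move=> FC; elim: r => [|i r IH].
  by apply: (@ccont_ext _ _ (fun=> 0)) (ccont_cst _ _) => x; rewrite big_nil.
apply: (@ccont_ext _ _ (fun x => F i x + \sum_(i <- r) F i x)).
  by move=> x; rewrite big_cons.
exact: ccontD.
Qed.

(** Real coordinates: all the real parts, followed by all the imaginary parts. *)
Definition mx_of_coord p m (x : 'rV[R]_(p * m + p * m)) : 'M[C]_(p, m) :=
  \matrix_(r, c) (vec_mx (lsubmx x) r c +i* vec_mx (rsubmx x) r c)%C.

Lemma mx_of_coord_surj p m (B : 'M[C]_(p, m)) : exists x, mx_of_coord x = B.
Proof.
exists (row_mx (mxvec (map_mx (@complex.Re R) B)) (mxvec (map_mx (@complex.Im R) B))).
apply/matrixP=> r c; rewrite mxE row_mxKl row_mxKr !mxvecK !mxE.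
by case: (B r c).
Qed.

Lemma ccont_mx_of_coord p m r c : ccont (fun x => @mx_of_coord p m x r c).
Proof.
split.
  apply: (@continuous_ext _ _
    (fun x : 'rV[R]__ => x ord0 (lshift _ (mxvec_index r c)))).
    by move=> y; rewrite !mxE.
  exact: coord_continuous.
apply: (@continuous_ext _ _
  (fun x : 'rV[R]__ => x ord0 (rshift _ (mxvec_index r c)))).
  by move=> y; rewrite !mxE.
exact: coord_continuous.
Qed.

Definition nsq (z : C) : R := complex.Re z ^+ 2 + complex.Im z ^+ 2.

Lemma nsq_ge0 z : 0 <= nsq z.
Proof. by rewrite addr_ge0 ?sqr_ge0. Qed.

Lemma ccont_nsq n (F : 'rV[R]_n -> C) : ccont F -> continuous (fun x => nsq (F x)).
Proof.
move=> [F1 F2] x; exact: (continuousD (continuousM (F1 x) (F1 x))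
                                      (continuousM (F2 x) (F2 x))).
Qed.

Lemma continuous_bigsum n (I : Type) (r : seq I) (F : I -> 'rV[R]_n -> R) :
  (forall i, continuous (F i)) -> continuous (fun x => \sum_(i <- r) F i x).
Proof.
move=> FC; elim: r => [|i r IH].
  apply: (@continuous_ext _ _ (fun=> 0)) => [x|x]; first by rewrite big_nil.
  exact: cst_continuous.
apply: (@continuous_ext _ _ (fun x => F i x + \sum_(i <- r) F i x)).
  by move=> x; rewrite big_cons.
by move=> x; exact: (continuousD (FC i x) (IH x)).
Qed.

Lemma complex_mx_min p m (f : 'M[C]_(p, m) -> R) (K : R) :
  continuous (f \o @mx_of_coord p m) ->
  (forall B, f B <= f 0 -> forall r c, nsq (B r c) <= K) ->
  exists B0, forall B, f B0 <= f B.
Proof.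
move=> fC fK.
have e0 : mx_of_coord 0 = 0 :> 'M[C]_(p, m).
  by apply/matrixP => r c; rewrite !mxE.
have bd (x y : R) : nsq (x +i* y)%C <= `|K| -> `|x| <= `|K| + 1 /\ `|y| <= `|K| + 1.
  by rewrite /nsq /= => H; split; rewrite ler_norml; nra.
have [||x0 x0min] := @coercive_min _ _ (`|K| + 1) fC.
- by rewrite addr_ge0.
- move=> x; rewrite /= e0 => /fK xK i.
  have lift_K r c : nsq (mx_of_coord x r c) <= `|K|.
    by apply: le_trans (xK r c) _; rewrite ler_norm.
  case: (split_ordP i) => j ->; case/mxvec_indexP: j => r c;
    by have := lift_K r c; rewrite !mxE => /bd [].
exists (mx_of_coord x0) => B; have [x <-] := mx_of_coord_surj B.
exact: x0min.
Qed.
End Minimum.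

(** * Conic duality for sesquilinear forms *)

Section Farkas.
Variable R : realType.
Local Notation C := (complex R).
Local Notation re := (@complex.Re R).

Lemma reD (x y : C) : re (x + y) = re x + re y.
Proof. by case: x y => ? ? []. Qed.

Lemma reN (x : C) : re (- x) = - re x.
Proof. by case: x. Qed.

Lemma re_sum (I : Type) (r : seq I) (F : I -> C) :
  re (\sum_(i <- r) F i) = \sum_(i <- r) re (F i).
Proof. exact: (big_morph _ reD (erefl _)). Qed.

Lemma nsqDZ (r q : C) (t : R) :
  nsq (r + t%:C%C * q) = nsq r + (t * re (r^* * q)) *+ 2 + t ^+ 2 * nsq q.
Proof. by case: r q => a b [c d]; rewrite /nsq /=; ring. Qed.

(** The quotient of the increment by t tends to twice the right-hand side as t
    decreases to 0. *)
Lemma first_variation (K : finType) (r q : K -> C) :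
  (forall t : R, 0 <= t <= 1 ->
     \sum_k nsq (r k) <= \sum_k nsq (r k + t%:C%C * q k)) ->
  0 <= re (\sum_k (r k)^* * q k).
Proof.
move=> H; set S := re _.
pose Q := \sum_k nsq (q k).
have Q0 : 0 <= Q by apply: sumr_ge0 => k _; exact: nsq_ge0.
have {}H t : 0 <= t <= 1 -> 0 <= t * S *+ 2 + t ^+ 2 * Q.
  move=> /H; under [X in _ <= X]eq_bigr do rewrite nsqDZ.
  rewrite !big_split /= -addrA lerDl -!mulr_sumr.
  by rewrite mulr2n /S re_sum.
case: (leP 0 S) => // S0.
(* This t lies in the unit interval and makes 2 t S + t^2 Q negative. *)
pose t := - S / (Q - S + 1).
have den : 0 < Q - S + 1 by lra.
have t0 : 0 < t by rewrite divr_gt0 // oppr_gt0.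
have t1 : t <= 1 by rewrite ler_pdivrMr //; lra.
have tE : t * (Q - S + 1) = - S by rewrite /t divfK // gt_eqF.
have := H t; rewrite (ltW t0) t1 => /(_ isT).
nra.
Qed.

Definition sesquilinear m (b : 'rV[C]_m -> 'rV[C]_m -> C) :=
  (forall a z z' u, b (a *: z + z') u = a^* * b z u + b z' u) /\
  (forall a z u u', b z (a *: u + u') = a * b z u + b z u').

Section Sesqui.
Variables (m : nat) (b : 'rV[C]_m -> 'rV[C]_m -> C).
Hypothesis bS : sesquilinear b.

Lemma sesqui0l u : b 0 u = 0.
Proof.
have := bS.1 1 0 0 u; rewrite scaler0 addr0 conjC1 mul1r => /eqP.
by rewrite -subr_eq subrr => /eqP.
Qed.

Lemma sesqui0r z : b z 0 = 0.
Proof.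
have := bS.2 1 z 0 0; rewrite scaler0 addr0 mul1r => /eqP.
by rewrite -subr_eq subrr => /eqP.
Qed.

Lemma sesquiZl a z u : b (a *: z) u = a^* * b z u.
Proof. by rewrite -[a *: z]addr0 bS.1 sesqui0l addr0. Qed.

Lemma sesquiZr a z u : b z (a *: u) = a * b z u.
Proof. by rewrite -[a *: u]addr0 bS.2 sesqui0r addr0. Qed.

Lemma sesquiDl z z' u : b (z + z') u = b z u + b z' u.
Proof. by rewrite -{1}[z]scale1r bS.1 conjC1 mul1r. Qed.

Lemma sesquiDr z u u' : b z (u + u') = b z u + b z u'.
Proof. by rewrite -{1}[u]scale1r bS.2 mul1r. Qed.

Lemma sesqui_sumZl (I : finType) (a : I -> C) (z : I -> 'rV_m) u :
  b (\sum_i a i *: z i) u = \sum_i (a i)^* * b (z i) u.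
Proof.
rewrite (big_morph (b^~ u) (fun z z' => sesquiDl z z' u) (sesqui0l u)).
by apply: eq_bigr => i _; rewrite sesquiZl.
Qed.

Lemma sesqui_sumZr (I : finType) (a : I -> C) (z : I -> 'rV_m) u :
  b u (\sum_i a i *: z i) = \sum_i a i * b u (z i).
Proof.
rewrite (big_morph (b u) (sesquiDr u) (sesqui0r u)).
by apply: eq_bigr => i _; rewrite sesquiZr.
Qed.

(** As B runs over all matrices with at least m rows, this is the value at an
    arbitrary positive semidefinite matrix of the linear functional induced by b. *)
Definition gram p (B : 'M[C]_(p, m)) := \sum_r b (row r B) (row r B).

Lemma gramE p (B : 'M[C]_(p, m)) : gram B =
  \sum_r \sum_c \sum_d (B r c)^* * (B r d * b (delta_mx 0 c) (delta_mx 0 d)).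
Proof.
apply: eq_bigr => r _; rewrite [X in b X _]row_sum_delta sesqui_sumZl.
apply: eq_bigr => c _; rewrite [X in b _ X]row_sum_delta sesqui_sumZr mulr_sumr.
by rewrite !mxE; apply: eq_bigr => d _; rewrite !mxE.
Qed.

Lemma gramZ p (B : 'M[C]_(p, m)) (a : C) : gram (a *: B) = a^* * a * gram B.
Proof.
rewrite /gram mulr_sumr; apply: eq_bigr => r _.
by rewrite linearZ /= sesquiZl sesquiZr mulrA.
Qed.

(** The cross terms vanish because u kills B, so that the positive semidefinite
    matrix given by B moves exactly in the direction given by v.  This replaces a
    factorization of the perturbed matrix. *)
Lemma gram_perturb p (B : 'M[C]_(p, m)) (u : 'rV[C]_p) (a : C) (v : 'rV_m) :
  u *m B = 0 ->
  gram (B + a *: (u^t* *m v)) = gram B + a^* * a * (\sum_r u 0 r * (u 0 r)^*) * b v v.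
Proof.
move=> uB.
have rowE r : row r (B + a *: (u^t* *m v)) = (a * (u 0 r)^*) *: v + row r B.
  apply/rowP => c; rewrite !mxE addrC big_ord1 !mxE mulrA.
  by [].
rewrite /gram.
under eq_bigr do rewrite rowE bS.1 !bS.2 mulrDr.
rewrite !big_split /=.
have -> : \sum_i (a * (u 0 i)^*)^* * b v (row i B) = 0.
  transitivity (b v (\sum_i (a * (u 0 i)^*)^* *: row i B)).
    by rewrite sesqui_sumZr.
  rewrite -(sesqui0r v); congr (b v _).
  under eq_bigr do rewrite rmorphM /= conjCK -scalerA.
  rewrite -scaler_sumr -mulmx_sum_row uB scaler0 //.
have -> : \sum_i (a * (u 0 i)^*) * b (row i B) v = 0.
  transitivity (b (\sum_i (a * (u 0 i)^*)^* *: row i B) v).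
    by rewrite sesqui_sumZl; under [RHS]eq_bigr do rewrite conjCK.
  rewrite -(sesqui0l v); congr (b _ v).
  under eq_bigr do rewrite rmorphM /= conjCK -scalerA.
  rewrite -scaler_sumr -mulmx_sum_row uB scaler0 //.
rewrite addr0 add0r addrC; congr (_ + _).
rewrite mulr_sumr mulr_suml; apply: eq_bigr => r _.
rewrite rmorphM /= conjCK; ring.
Qed.
End Sesqui.

Lemma ccont_gram m (b : 'rV[C]_m -> 'rV[C]_m -> C) p : sesquilinear b ->
  ccont (fun x => gram b (@mx_of_coord R p m x)).
Proof.
move=> bS; rewrite (funext (fun x => gramE bS (@mx_of_coord R p m x))).
do 3![apply: ccont_sum => ?].
apply: ccontM; first exact/ccont_conj/ccont_mx_of_coord.
by apply: ccontM; [exact: ccont_mx_of_coord | exact: ccont_cst].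
Qed.

Lemma re_mul_le (x y : C) : re (x * y) *+ 2 <= nsq x + nsq y.
Proof.
case: x y => a b [c d]; rewrite /nsq /=.
by have := sqr_ge0 (a - c); have := sqr_ge0 (b + d); nra.
Qed.

(** The cone is the set of all families of values [gram (beta k) B]; the
    hypothesis on y0 is a Slater condition.  It makes the squared distance from
    the cone to b coercive in B, so that a minimizer B0 exists.  If its residual
    r is not 0, then r pairs nonnegatively with every direction of the cone and
    negatively with b.  One row more than m is allowed so that B0 always has
    a left kernel vector along which a new direction can be added. *)
Lemma sesqui_farkas (K : finType) m (beta : K -> 'rV[C]_m -> 'rV[C]_m -> C)
    (b y0 : K -> C) (c : R) :
  (forall k, sesquilinear (beta k)) -> 0 < c ->
  (forall z : 'rV_m, c * (\sum_i nsq (z 0 i)) <= re (\sum_k y0 k * beta k z z)) ->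
  (exists B : 'M[C]_(m.+1, m), forall k, gram (beta k) B = b k) \/
  (exists y : K -> C, (forall z, 0 <= re (\sum_k y k * beta k z z)) /\
     re (\sum_k y k * b k) < 0).
Proof.
move=> bS c0 slater.
pose res k (B : 'M[C]_(m.+1, m)) := gram (beta k) B - b k.
pose f B := \sum_k nsq (res k B).
have fC : continuous (f \o @mx_of_coord R m.+1 m).
  apply: continuous_bigsum => k; apply: ccont_nsq.
  by apply: ccontD; [exact: ccont_gram | exact: ccont_cst].
have coer (B : 'M_(m.+1, m)) :
    c * (\sum_r \sum_i nsq (B r i)) <= re (\sum_k y0 k * gram (beta k) B).
  apply: (@le_trans _ _ (\sum_r re (\sum_k y0 k * beta k (row r B) (row r B)))).
    rewrite mulr_sumr; apply: ler_sum => r _; apply: le_trans (slater (row r B)).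
    by rewrite le_eqVlt; apply/orP; left; apply/eqP; congr (_ * _);
      apply: eq_bigr => i _; rewrite mxE.
  rewrite -re_sum exchange_big /=; under eq_bigr do rewrite -mulr_sumr.
  exact: lexx.
pose D := re (\sum_k y0 k * b k) *+ 2 + \sum_k nsq (y0 k).
have bound (B : 'M_(m.+1, m)) : (c * (\sum_r \sum_i nsq (B r i))) *+ 2 <= f B + D.
  apply: le_trans (_ : re (\sum_k y0 k * gram (beta k) B) *+ 2 <= _).
    by rewrite lerMn2r coer orbT.
  have -> : \sum_k y0 k * gram (beta k) B
      = \sum_k y0 k * b k + \sum_k y0 k * res k B.
    by rewrite -big_split /=; apply: eq_bigr => k _; rewrite -mulrDr /res addrC subrK.
  have : re (\sum_k y0 k * res k B) *+ 2 <= \sum_k nsq (y0 k) + f B.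
    rewrite re_sum -sumrMnl /f -big_split /=.
    by apply: ler_sum => k _; exact: re_mul_le.
  by rewrite reD /D; lra.
have [|B0 B0min] := @complex_mx_min R _ _ f ((f 0 + D) / c) fC.
  move=> B fB r i; rewrite ler_pdivlMr // mulrC.
  have /le_trans : nsq (B r i) <= \sum_r \sum_i nsq (B r i).
    rewrite (bigD1 r) //= (bigD1 i) //= -addrA lerDl addr_ge0 //.
      by apply: sumr_ge0 => j _; exact: nsq_ge0.
    by apply: sumr_ge0 => j _; apply: sumr_ge0 => j' _; exact: nsq_ge0.
  move=> H; have := bound B.
  have S0 : 0 <= \sum_r \sum_i nsq (B r i).
    by apply: sumr_ge0 => j _; apply: sumr_ge0 => j' _; exact: nsq_ge0.
  have : c * nsq (B r i) <= c * (\sum_r \sum_i nsq (B r i)) by rewrite ler_pM2l// H.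
  move: fB; rewrite mulr2n; nra.
have [res0|/existsNP [k0 /eqP resN0]] := pselect (forall k, res k B0 = 0).
  by left; exists B0 => k; apply/eqP; rewrite -subr_eq0; apply/eqP/res0.
right; exists (fun k => (res k B0)^*); split=> [z|].
  (* Move B0 in the direction of z. *)
  have /rowV0Pn[u /sub_kermxP uB u0] : kermx B0 != 0.
    rewrite -mxrank_eq0 mxrank_ker subn_eq0 -ltnNge ltnS.
    exact: rank_leq_col.
  pose kap := \sum_r u 0 r * (u 0 r)^*.
  have kap0 : 0 < kap.
    rewrite lt_def; apply/andP; split; last first.
      by apply: sumr_ge0 => r _; rewrite -normCK exprn_ge0.
    apply: contraNneq u0 => /eqP; rewrite psumr_eq0; last first.
      by move=> r _; rewrite -normCK exprn_ge0.
    move=> /allP u0; apply/eqP/rowP => r; rewrite mxE.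
    have := u0 r (mem_index_enum _); rewrite /= -normCK sqrf_eq0 normr_eq0.
    by move=> /eqP.
  apply: first_variation => t /andP[t0 t1].
  pose a := sqrtC (t%:C%C / kap).
  have aE : a^* * a * kap = t%:C%C.
    have a0 : 0 <= a by rewrite sqrtC_ge0 divr_ge0 ?(ltW kap0) // lecR.
    by rewrite conj_Creal ?ger0_real // -expr2 sqrtCK divfK // gt_eqF.
  have := B0min (B0 + a *: (u^t* *m z)); rewrite /f.
  have E k : res k (B0 + a *: (u^t* *m z)) = res k B0 + t%:C%C * beta k z z.
    by rewrite /res gram_perturb // aE; ring.
  by under [X in _ <= X]eq_bigr do rewrite E.
(* Shrink B0: since b is the value at B0 minus the residual, nonnegativity along
   minus this value leaves minus the square of the residual. *)
have -> : \sum_k (res k B0)^* * b k =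
    - (\sum_k (res k B0)^* * (res k B0) + \sum_k (res k B0)^* * - gram (beta k) B0).
  rewrite -big_split -sumrN /=; apply: eq_bigr => k _.
  by rewrite -mulrDr -mulrN; congr (_ * _); rewrite /res; ring.
rewrite reN oppr_lt0 reD ltr_wpDr //.
  apply: first_variation => t /andP[t0 t1].
  pose a := sqrtC (1 - t)%:C%C.
  have aE : a^* * a = (1 - t)%:C%C.
    have a0 : 0 <= a by rewrite sqrtC_ge0 lecR subr_ge0.
    by rewrite conj_Creal ?ger0_real // -expr2 sqrtCK.
  have := B0min (a *: B0); rewrite /f.
  under [X in _ <= X]eq_bigr => k _ do rewrite /res gramZ // aE.
  move=> /le_trans; apply; rewrite le_eqVlt; apply/orP; left; apply/eqP.
  apply: eq_bigr => k _; congr nsq; rewrite /res rmorphB rmorph1; ring.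
have nsqE z : re (z^* * z) = nsq z by case: z => x y; rewrite /nsq /=; ring.
rewrite re_sum (bigD1 k0) //= ltr_pwDl //.
  rewrite nsqE lt_def nsq_ge0 andbT.
  apply: contraNneq resN0; case: (res k0 B0) => x y /= /eqP.
  rewrite /nsq /= paddr_eq0 ?sqr_ge0 // !sqrf_eq0 => /andP[/eqP -> /eqP ->].
  by [].
by apply: sumr_ge0 => k _; rewrite nsqE nsq_ge0.
Qed.
End Farkas.

(** * Adjoints of complex matrices *)

Section Adjoint.
Variable C : numClosedFieldType.

Lemma adjmxE m n (A : 'M[C]_(m, n)) i j : (A^t*) i j = (A j i)^*.
Proof. by rewrite !mxE. Qed.

Lemma adjmxD m n (A B : 'M[C]_(m, n)) : (A + B)^t* = A^t* + B^t*.
Proof. by rewrite linearD /= map_mxD. Qed.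

Lemma adjmxZ m n (c : C) (A : 'M[C]_(m, n)) : (c *: A)^t* = c^* *: A^t*.
Proof. by rewrite linearZ /= map_mxZ. Qed.

Lemma adjmx0 m n : (0 : 'M[C]_(m, n))^t* = 0.
Proof. by rewrite trmx0 map_mx0. Qed.

Lemma adjmx1 n : (1%:M : 'M[C]_n)^t* = 1%:M.
Proof. by apply/matrixP => i j; rewrite !mxE rmorph_nat eq_sym. Qed.

Lemma adjmxM m n p (A : 'M[C]_(m, n)) (B : 'M[C]_(n, p)) :
  (A *m B)^t* = B^t* *m A^t*.
Proof. by rewrite trmx_mul map_mxM. Qed.

Lemma adjmx_sum m n (I : Type) (r : seq I) (Q : pred I) (F : I -> 'M[C]_(m, n)) :
  (\sum_(i <- r | Q i) F i)^t* = \sum_(i <- r | Q i) (F i)^t*.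
Proof. exact: (big_morph (fun M : 'M_(m, n) => M^t*) (@adjmxD _ _) (adjmx0 _ _)). Qed.

Lemma mxtrace_adj n (A : 'M[C]_n) : \tr (A^t*) = (\tr A)^*.
Proof. by rewrite /mxtrace rmorph_sum; apply: eq_bigr => i _; rewrite adjmxE. Qed.
End Adjoint.

(** * The involution on noncommutative polynomials *)

Section Star.
Variables (C : numClosedFieldType) (g : nat).
Local Notation P := (ncpoly C g).

Lemma star_letterK : involutive (@star_letter g).
Proof. by case. Qed.

Lemma star_wordE (w : word g) : star_word w = rev (map (@star_letter g) w) :> seq _.
Proof. by []. Qed.

Lemma word_inj (u v : word g) : u = v :> seq _ -> u = v.
Proof. by move=> uv; apply/eqP; rewrite fmP uv. Qed.

Lemma star_wordK : involutive (@star_word g).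
Proof.
move=> w; apply: word_inj; rewrite !star_wordE map_rev revK -map_comp.
by rewrite (eq_map star_letterK) map_id.
Qed.

Lemma star_wordM (u v : word g) :
  star_word (mmul u v) = mmul (star_word v) (star_word u).
Proof. by apply: word_inj; rewrite fmM !star_wordE fmM map_cat rev_cat. Qed.

Lemma starE (p : P) : star p = \sum_(w <- msupp p) << (p@_w)^* *g star_word w >>.
Proof. by []. Qed.

Lemma mcoeff_star (p : P) u : (star p)@_u = (p@_(star_word u))^*.
Proof.
rewrite /star raddf_sum /=; under eq_bigr do rewrite mcoeffU.
case: (msuppP p (star_word u)) => [us|us].
  rewrite (big_fsetD1 _ us) /= star_wordK eqxx mulr1n big1_fset ?addr0 // => w.
  rewrite !inE => /andP[wu _] _; case: eqP => // E.
  by rewrite -E star_wordK eqxx in wu.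
rewrite big1_fset ?conjC0 // => w ws _; case: eqP => // E.
by rewrite -E star_wordK ws in us.
Qed.

Lemma starD : {morph @star C g : p q / p + q}.
Proof.
move=> p q; apply/malgP => w; apply: etrans (mcoeff_star _ _) _.
rewrite [RHS]mcoeffD mcoeffD rmorphD.
by congr (_ + _); apply/esym/mcoeff_star.
Qed.

Lemma star0 : star (0 : P) = 0.
Proof. by apply/malgP => w; rewrite mcoeff_star !mcoeff0 conjC0. Qed.

Lemma star_sum (I : Type) (r : seq I) (Q : pred I) (F : I -> P) :
  star (\sum_(i <- r | Q i) F i) = \sum_(i <- r | Q i) star (F i).
Proof. exact: (big_morph _ starD star0). Qed.

Lemma starU c w : star (<< c *g w >> : P) = << c^* *g star_word w >>.
Proof.
apply/malgP => u; rewrite mcoeff_star !mcoeffU (can2_eq star_wordK star_wordK).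
by rewrite rmorphMn.
Qed.

Lemma mulUU c1 c2 (w1 w2 : word g) :
  << c1 *g w1 >> * << c2 *g w2 >> = << c1 * c2 *g mmul w1 w2 >> :> P.
Proof. by rewrite malgM_def fgmulUU. Qed.

Lemma starM (p q : P) : star (p * q) = star q * star p.
Proof.
rewrite malgME star_sum (starE p) mulr_sumr; apply: eq_bigr => u _.
rewrite star_sum (starE q) mulr_suml; apply: eq_bigr => v _.
by rewrite mulUU !starU star_wordM rmorphM mulrC.
Qed.

Lemma starmxM a b c (p : 'M[P]_(a, b)) (q : 'M[P]_(b, c)) :
  starmx (p *m q) = starmx q *m starmx p.
Proof.
apply/matrixP => i j; rewrite !mxE star_sum; apply: eq_bigr => k _.
by rewrite !mxE starM.
Qed.
End Star.

(** * Evaluation at a matrix tuple *)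

Section Eval.
Variables (C : numClosedFieldType) (g n : nat) (X : 'I_g -> 'M[C]_n).
Local Notation P := (ncpoly C g).
Local Notation evw := (eval_word X).

Lemma eval_wordE (s : seq (letter g)) (w : word g) : w = s :> seq _ ->
  evw w = foldr (fun a M => eval_letter X a *m M) 1%:M s.
Proof. by move=> ws; rewrite /eval_word ws unlock. Qed.

Lemma eval_wordM (u v : word g) : evw (mmul u v) = evw u *m evw v.
Proof.
rewrite (eval_wordE (fmM u v)) (@eval_wordE u u) // (@eval_wordE v v) //.
by elim: (u : seq _) => [|a s IH] /=; rewrite ?mul1mx // IH mulmxA.
Qed.

Lemma eval_word1 : evw mone = 1%:M.
Proof. by rewrite (eval_wordE (@fm1 _)). Qed.

Lemma eval_letter_star a : eval_letter X (star_letter a) = (eval_letter X a)^t*.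
Proof. by case: a => j //=; rewrite trmxCK. Qed.

Lemma eval_word_star (w : word g) : evw (star_word w) = (evw w)^t*.
Proof.
rewrite (eval_wordE (star_wordE w)) (@eval_wordE w w) //.
elim: (w : seq _) => [|a s IH] /=; first by rewrite adjmx1.
rewrite adjmxM -IH rev_cons -cats1.
elim: (rev _) => [|b r IHr] /=; first by rewrite mulmx1 mul1mx eval_letter_star.
by rewrite IHr mulmxA.
Qed.

(** Evaluation of one entry; a matrix polynomial is evaluated blockwise by it. *)
Definition evalp (p : P) : 'M[C]_n := \sum_(w <- msupp p) p@_w *: evw w.

Lemma evalpE (p : P) : evalp p = \sum_(w <- msupp p) p@_w *: evw w.
Proof. by []. Qed.

Lemma evalpEw (p : P) (D : {fset word g}) : (msupp p `<=` D)%fset ->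
  evalp p = \sum_(w <- D) p@_w *: evw w.
Proof.
move=> pD; rewrite /evalp; apply: big_fset_incl => // w _ wp.
by rewrite mcoeff_outdom // scale0r.
Qed.

Lemma evalpD : {morph evalp : p q / p + q}.
Proof.
move=> p q; set D := (msupp p `|` msupp q)%fset.
rewrite (@evalpEw p D) ?fsubsetUl // (@evalpEw q D) ?fsubsetUr //.
rewrite (@evalpEw (p + q) D) ?msuppD_le // -big_split /=.
by apply: eq_bigr => w _; rewrite mcoeffD scalerDl.
Qed.

Lemma evalp0 : evalp 0 = 0.
Proof. by rewrite /evalp msupp0 big_seq_fset0. Qed.

Lemma evalp_sum (I : Type) (r : seq I) (Q : pred I) (F : I -> P) :
  evalp (\sum_(i <- r | Q i) F i) = \sum_(i <- r | Q i) evalp (F i).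
Proof. exact: (big_morph _ evalpD evalp0). Qed.

Lemma evalpU c w : evalp << c *g w >> = c *: evw w.
Proof.
by rewrite (@evalpEw _ [fset w]%fset) ?msuppU_le // big_seq_fset1 mcoeffUU.
Qed.

Lemma evalpM (p q : P) : evalp (p * q) = evalp p *m evalp q.
Proof.
rewrite malgME evalp_sum (evalpE p) mulmx_suml; apply: eq_bigr => u _.
rewrite evalp_sum (evalpE q) mulmx_sumr; apply: eq_bigr => v _.
by rewrite evalpU eval_wordM -scalemxAl -scalemxAr scalerA.
Qed.

Lemma evalp_star (p : P) : evalp (star p) = (evalp p)^t*.
Proof.
rewrite starE evalp_sum evalpE adjmx_sum.
by apply: eq_bigr => w _; rewrite evalpU eval_word_star adjmxZ.
Qed.

Lemma evalpZ c (p : P) : evalp (c *: p) = c *: evalp p.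
Proof.
rewrite (@evalpEw _ (msupp p)) ?msuppZ_le // /evalp scaler_sumr.
by apply: eq_bigr => w _; rewrite mcoeffZ scalerA.
Qed.

Lemma evalp1 : evalp 1 = 1%:M.
Proof. by rewrite -mpolyC1E evalpU eval_word1 scale1r. Qed.

Lemma evalp_var a : evalp (var C a) = eval_letter X a.
Proof.
rewrite /var evalpU scale1r (eval_wordE (fmU a)) /= mulmx1 //.
Qed.

Lemma evalmxE a b (p : 'M[P]_(a, b)) i j k l :
  evalmx X p (mxtens_index (i, k)) (mxtens_index (j, l)) = evalp (p i j) k l.
Proof.
rewrite /evalmx summxE (@evalpEw _ (suppmx p)); last first.
  apply/fsubsetP => w wp; apply/bigfcupP; exists (i, j) => //.
  by rewrite mem_index_enum.
rewrite summxE; apply: eq_bigr => w _.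
by rewrite tensmxE !mxE.
Qed.

Lemma mxtensP a b c d (M N : 'M[C]_(a * c, b * d)) :
  (forall i j k l, M (mxtens_index (i, k)) (mxtens_index (j, l))
                 = N (mxtens_index (i, k)) (mxtens_index (j, l))) -> M = N.
Proof.
move=> MN; apply/matrixP => i j; rewrite -(mxtens_unindexK i) -(mxtens_unindexK j).
by case: (mxtens_unindex i) (mxtens_unindex j) => ? ? [].
Qed.

Lemma sum_mxtens a b (F : 'I_(a * b) -> C) :
  \sum_i F i = \sum_i \sum_k F (mxtens_index (i, k)).
Proof.
rewrite pair_big /= (reindex (@mxtens_index a b)) /=.
  by apply: eq_bigr => -[].
by exists (@mxtens_unindex a b) => i _; rewrite ?mxtens_indexK ?mxtens_unindexK.
Qed.

Lemma evalmxD a b : {morph @evalmx C g n X a b : p q / p + q}.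
Proof.
by move=> p q; apply: mxtensP => i j k l; rewrite [RHS]mxE !evalmxE mxE evalpD mxE.
Qed.

Lemma evalmx0 a b : evalmx X (0 : 'M[P]_(a, b)) = 0.
Proof.
by apply: mxtensP => i j k l; rewrite evalmxE !mxE evalp0 mxE.
Qed.

Lemma evalmx_sum a b (I : Type) (r : seq I) (Q : pred I) (F : I -> 'M[P]_(a, b)) :
  evalmx X (\sum_(i <- r | Q i) F i) = \sum_(i <- r | Q i) evalmx X (F i).
Proof. exact: (big_morph _ (@evalmxD a b) (evalmx0 a b)). Qed.

Lemma evalmxM a b c (p : 'M[P]_(a, b)) (q : 'M[P]_(b, c)) :
  evalmx X (p *m q) = evalmx X p *m evalmx X q.
Proof.
apply: mxtensP => i j k l; rewrite evalmxE [RHS]mxE sum_mxtens mxE evalp_sum summxE.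
apply: eq_bigr => r _; rewrite evalpM mxE; apply: eq_bigr => s _.
by rewrite !evalmxE.
Qed.

Lemma evalmx_star a b (p : 'M[P]_(a, b)) : evalmx X (starmx p) = (evalmx X p)^t*.
Proof.
by apply: mxtensP => i j k l; rewrite adjmxE !evalmxE mxE evalp_star adjmxE.
Qed.

Lemma evalmx1 a : evalmx X (1%:M : 'M[P]_a) = 1%:M.
Proof.
apply: mxtensP => i j k l; rewrite evalmxE !mxE.
rewrite (can_eq (@mxtens_indexK _ _)) xpair_eqE.
by case: (i == j); rewrite ?mulr1n ?mulr0n ?evalp1 ?evalp0 mxE.
Qed.

Lemma evalmx_scalevar a b (A : 'M[C]_(a, b)) x :
  evalmx X (scalevar A x) = A *t eval_letter X x.
Proof.
by apply: mxtensP => i j k l; rewrite evalmxE tensmxE mxE evalpZ evalp_var mxE.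
Qed.

Lemma evalmx_pencil l (A : 'I_g -> 'M[C]_l) :
  evalmx X (pencil A) = 1%:M + \sum_j A j *t X j + \sum_j (A j)^t* *t (X j)^t*.
Proof.
apply: etrans (evalmxD _ _) _; rewrite evalmx_sum.
apply: etrans (congr1 (+%R^~ _) (evalmxD _ _)) _; rewrite evalmx_sum evalmx1.
by congr (_ + _ + _); apply: eq_bigr => j _; rewrite evalmx_scalevar.
Qed.
End Eval.

(** * Certificates are positive on the spectrahedron *)

Section Psd.
Variable C : numClosedFieldType.

Lemma psdmx_sandwich n m (M : 'M[C]_n) (V : 'M[C]_(n, m)) :
  psdmx M -> psdmx (V^t* *m M *m V).
Proof.
move=> [MH M0]; split; first by rewrite !adjmxM trmxCK MH mulmxA.
by move=> v; have := M0 (V *m v); rewrite adjmxM !mulmxA.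
Qed.

Lemma psdmxD n (M N : 'M[C]_n) : psdmx M -> psdmx N -> psdmx (M + N).
Proof.
move=> [MH M0] [NH N0]; split; first by rewrite adjmxD MH NH.
by move=> v; rewrite mulmxDr mulmxDl mxE addr_ge0.
Qed.

Lemma psdmx0 n : psdmx (0 : 'M[C]_n).
Proof. by split=> [|v]; rewrite ?adjmx0 // mulmx0 mul0mx mxE. Qed.

Lemma gramnorm_ge0 n (v : 'cV[C]_n) : 0 <= (v^t* *m v) 0 0.
Proof.
rewrite mxE sumr_ge0 // => i _.
by rewrite adjmxE mulrC -normCK exprn_ge0.
Qed.

Lemma psdmx1 n : psdmx (1%:M : 'M[C]_n).
Proof. by split=> [|v]; rewrite ?adjmx1 // mulmx1 gramnorm_ge0. Qed.

Lemma psdmx_sum n (I : eqType) (r : seq I) (F : I -> 'M[C]_n) :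
  (forall i, i \in r -> psdmx (F i)) -> psdmx (\sum_(i <- r) F i).
Proof.
elim: r => [|i r IH] F0; first by rewrite big_nil; exact: psdmx0.
rewrite big_cons; apply: psdmxD; first by apply: F0; rewrite mem_head.
by apply: IH => j jr; apply: F0; rewrite inE jr orbT.
Qed.

Section Certified.
Variables (g l nu : nat) (A : 'I_g -> 'M[C]_l).

Lemma psd_of_pencil_certificate (fs : seq 'M[ncpoly C g]_(l, nu)) :
  psd_on_spectrahedron A (\sum_(f <- fs) (starmx f *m pencil A *m f)).
Proof.
move=> n X LX; rewrite evalmx_sum; apply: psdmx_sum => f _.
by rewrite evalmxM evalmxM evalmx_star; apply: psdmx_sandwich.
Qed.

Lemma psd_of_certificate (hs fs : seq 'M[ncpoly C g]_(l, nu)) :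
  psd_on_spectrahedron A (\sum_(p <- hs) (starmx p *m p)
             + \sum_(f <- fs) (starmx f *m pencil A *m f)).
Proof.
move=> n X LX; rewrite evalmxD; apply: psdmxD; last exact: psd_of_pencil_certificate.
rewrite evalmx_sum; apply: psdmx_sum => p _.
rewrite evalmxM evalmx_star -[X in X *m _]mulmx1.
exact/psdmx_sandwich/psdmx1.
Qed.
End Certified.
End Psd.

(** * Positive definite matrices, tensor products and selections *)

Section LinAlg.
Variable C : numClosedFieldType.

(** Spectral theorem: the factor is the adjoint of the diagonalizing unitary times
    the square root of the positive spectrum. *)
Lemma pd_factor n (Y : 'M[C]_n) : Y^t* = Y ->
  (forall v : 'rV[C]_n, v != 0 -> 0 < (v *m Y *m v^t*) 0 0) ->
  exists2 T, T \in unitmx & Y = T *m T^t*.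
Proof.
move=> YH Y0; have /orthomx_spectralP YE : Y \is normalmx.
  by apply/normalmxP; rewrite YH.
set Q := spectralmx Y in YE; set s := spectral_diag Y in YE.
have QU : Q \is unitarymx by exact: spectral_unitarymx.
have Qunit : Q \in unitmx by exact: spectral_unit.
have s0 i : 0 < s 0 i.
  have r0 : row i Q != 0.
    apply/negP => /eqP r0; have := row_mul i Q (invmx Q).
    rewrite mulmxV // r0 mul0mx => /rowP /(_ i).
    by rewrite !mxE eqxx => /eqP; rewrite oner_eq0.
  have := Y0 _ r0; rewrite YE !mulmxA.
  rewrite -row_mul mulmxV // -row_mul mul1mx -mulmxA.
  have -> : Q *m (row i Q)^t* = col i 1%:M.
    rewrite -(unitarymxP QU); apply/colP => j; rewrite !mxE.
    by apply: eq_bigr => k _; rewrite !mxE.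
  rewrite -row_mul colE mul1mx -colE !mxE eqxx mulr1n //.
pose q := diag_mx (\row_i sqrtC (s 0 i)).
exists (Q^t* *m q).
  rewrite unitmx_mul map_unitmx unitmx_tr Qunit /=.
  rewrite unitmxE det_diag unitfE prodf_seq_neq0.
  by apply/allP => i _; rewrite mxE /= sqrtC_eq0 gt_eqF.
rewrite adjmxM trmxCK [LHS]YE invmx_unitary // !mulmxA; congr (_ *m _).
rewrite -!mulmxA; congr (_ *m _); apply/matrixP => i j.
rewrite mxE mul_diag_mx !mxE eq_sym; case: eqP => [->|]; last by rewrite conjC0 mulr0.
rewrite !mulr1n conj_Creal ?ger0_real ?sqrtC_ge0 ?ltW // -expr2 sqrtCK //.
Qed.

(** Vectors of the tensor product are handled as l x n arrays, on which [A *t X]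
    acts by V |-> A V X^T. *)
Definition untensvec l n (v : 'cV[C]_(l * n)) : 'M[C]_(l, n) :=
  \matrix_(i, a) v (mxtens_index (i, a)) 0.

Definition tensvec l n (V : 'M[C]_(l, n)) : 'cV[C]_(l * n) :=
  \col_k V (mxtens_unindex k).1 (mxtens_unindex k).2.

Lemma tens_quad l n (A : 'M[C]_l) (X : 'M[C]_n) v :
  (v^t* *m (A *t X) *m v) 0 0 =
    \tr (A *m untensvec v *m X^T *m (untensvec v)^t*).
Proof.
rewrite -mulmxA mxE sum_mxtens /mxtrace; apply: eq_bigr => i _.
rewrite mxE; apply: eq_bigr => a _; rewrite adjmxE [RHS]mulrC !mxE; congr (_ * _).
rewrite sum_mxtens exchange_big /=; apply: eq_bigr => b _.
rewrite !mxE mulr_suml; apply: eq_bigr => k _.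
by rewrite tensmxE mxE mulrAC.
Qed.

Lemma adjmx_tens l n (A : 'M[C]_l) (X : 'M[C]_n) :
  (A *t X)^t* = A^t* *t X^t*.
Proof.
apply: mxtensP => i j k m.
by rewrite adjmxE !tensmxE !adjmxE rmorphM.
Qed.

Lemma tens11 l n : (1%:M : 'M[C]_l) *t (1%:M : 'M[C]_n) = 1%:M.
Proof.
apply: mxtensP => i j k m; rewrite tensmxE !mxE.
by rewrite (can_eq (@mxtens_indexK _ _)) xpair_eqE -natrM mulnb.
Qed.

(** Multiplying by this matrix on the right selects columns along f, and by its
    transpose on the left selects rows. *)
Definition selmx m n (f : 'I_n -> 'I_m) : 'M[C]_(m, n) :=
  \matrix_(a, b) (a == f b)%:R.

Lemma mul_selmx m n p (f : 'I_n -> 'I_m) (M : 'M[C]_(p, m)) a b :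
  (M *m selmx f) a b = M a (f b).
Proof.
rewrite mxE (bigD1 (f b)) //= mxE eqxx mulr1 big1 ?addr0 // => c /negPf cf.
by rewrite mxE cf mulr0.
Qed.

Lemma tr_selmx_mul m n p (f : 'I_n -> 'I_m) (M : 'M[C]_(m, p)) a b :
  ((selmx f)^T *m M) a b = M (f a) b.
Proof.
have -> : (selmx f)^T *m M = (M^T *m selmx f)^T by rewrite trmx_mul trmxK.
by rewrite mxE mul_selmx mxE.
Qed.

Lemma adj_selmx m n (f : 'I_n -> 'I_m) : (selmx f)^t* = (selmx f)^T.
Proof. by apply/matrixP => a b; rewrite !mxE rmorph_nat. Qed.

Lemma adj_trselmx m n (f : 'I_n -> 'I_m) : ((selmx f)^T)^t* = selmx f.
Proof. by rewrite -adj_selmx trmxCK. Qed.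

Lemma cross_adj l p (F : 'M[C]_(l, p)) (B : 'M[C]_l) (Z : 'M[C]_p) :
  \tr (B^t* *m F *m Z^t* *m F^t*) = (\tr (B *m F *m Z *m F^t*))^*.
Proof.
rewrite -mxtrace_adj adjmxM adjmxM adjmxM trmxCK.
by rewrite -!mulmxA [LHS]mxtrace_mulC -!mulmxA.
Qed.
End LinAlg.

(** * Indices of monomials of bounded degree *)

Section Index.
Variables (g nu : nat).

(** Pairs of a word of length at most D and a column are encoded as ordinals, so
    that they can index the rows and columns of matrices. *)
Definition nidx (D : nat) : nat := #|{: D.-bseq 'I_g * 'I_nu}|.

Definition idx_word D (a : 'I_(nidx D)) : seq 'I_g := (enum_val a).1.
Definition idx_col D (a : 'I_(nidx D)) : 'I_nu := (enum_val a).2.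
(** A word longer than D is sent to the empty word. *)
Definition mkidx D (s : seq 'I_g) (t : 'I_nu) : 'I_(nidx D) :=
  enum_rank (insub_bseq D s, t).

Lemma idx_col_mkidx D s t : idx_col (mkidx D s t) = t.
Proof. by rewrite /idx_col enum_rankK. Qed.

Lemma idx_word_mkidx D s t : (size s <= D)%N -> idx_word (mkidx D s t) = s.
Proof. by move=> sD; rewrite /idx_word enum_rankK /= /insub_bseq insubdK. Qed.

Lemma mkidxK D (a : 'I_(nidx D)) : mkidx D (idx_word a) (idx_col a) = a.
Proof.
rewrite /mkidx /idx_word /idx_col /insub_bseq valKd -surjective_pairing; exact: enum_valK.
Qed.

Lemma size_idx_word D (a : 'I_(nidx D)) : (size (idx_word a) <= D)%N.
Proof. exact: size_bseq. Qed.

Definition widen D (a : 'I_(nidx D)) := mkidx D.+1 (idx_word a) (idx_col a).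
Definition push D j (a : 'I_(nidx D)) := mkidx D.+1 (j :: idx_word a) (idx_col a).

Lemma idx_word_widen D (a : 'I_(nidx D)) : idx_word (widen a) = idx_word a.
Proof. by rewrite idx_word_mkidx // ltnW // ltnS size_idx_word. Qed.

Lemma widen_inj D : injective (@widen D).
Proof.
move=> a b E; rewrite -(mkidxK a) -(mkidxK b).
rewrite -(idx_word_widen a) -(idx_word_widen b) E.
by rewrite -{1}(idx_col_mkidx D.+1 (idx_word a) (idx_col a)) -/(widen a) E idx_col_mkidx.
Qed.

Lemma idx_col_widen D (a : 'I_(nidx D)) : idx_col (widen a) = idx_col a.
Proof. exact: idx_col_mkidx. Qed.

Lemma idx_word_push D j (a : 'I_(nidx D)) : idx_word (push j a) = j :: idx_word a.
Proof. by rewrite idx_word_mkidx // /= ltnS size_idx_word. Qed.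

Lemma idx_col_push D j (a : 'I_(nidx D)) : idx_col (push j a) = idx_col a.
Proof. exact: idx_col_mkidx. Qed.

Lemma idx_inj D (a b : 'I_(nidx D)) : idx_word a = idx_word b -> idx_col a = idx_col b -> a = b.
Proof. by move=> w c; rewrite -(mkidxK a) -(mkidxK b) w c. Qed.

Lemma push_mkidx D j s t : (size s < D)%N ->
  push j (mkidx D s t) = widen (mkidx D (j :: s) t).
Proof.
move=> sD; apply: idx_inj; last by rewrite idx_col_push idx_col_widen !idx_col_mkidx.
by rewrite idx_word_push idx_word_widen !idx_word_mkidx // ltnW.
Qed.
End Index.

(** * Gram matrices of hereditary polynomials *)

Section Regroup.
Variables (R : pzRingType) (a b c d e f : nat).
Variables (s : 'M[R]_(a, b)) (F' : 'M[R]_(b, c)).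
Variables (A : 'M[R]_(c, d)) (F : 'M[R]_(d, e)) (m : 'M[R]_(e, f)).

Lemma mulmx_move_right (V : 'M[R]_c) (V' : 'M[R]_e) :
  V *m (A *m F) = A *m F *m V' ->
  s *m F' *m (V *m A) *m (F *m m) = s *m (F' *m (A *m F)) *m (V' *m m).
Proof.
by move=> H; rewrite -!mulmxA [A *m (F *m m)]mulmxA [V *m _]mulmxA H -!mulmxA.
Qed.

Lemma mulmx_move_left (V : 'M[R]_c) (V' : 'M[R]_b) :
  F' *m V = V' *m F' ->
  s *m F' *m (V *m A) *m (F *m m) = s *m V' *m (F' *m (A *m F)) *m m.
Proof. by move=> H; rewrite -!mulmxA [F' *m (V *m _)]mulmxA H -!mulmxA. Qed.

Lemma mulmx_regroup :
  s *m (F' *m A *m F *m m) = s *m F' *m A *m (F *m m).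
Proof. by rewrite !mulmxA. Qed.
End Regroup.

Section Monomials.
Variables (C : numClosedFieldType) (g nu : nat).
Local Notation P := (ncpoly C g).

Definition xword (s : seq 'I_g) : word g := FMonom [seq inl j | j <- s].

Lemma xword_cons j s : xword (j :: s) = mmul (fmu (inl j)) (xword s).
Proof. by apply: word_inj; rewrite fmM fmU. Qed.

Definition cstmx a b (M : 'M[C]_(a, b)) : 'M[P]_(a, b) :=
  map_mx (fun c => (c%:MP : P)) M.

Lemma cstmxM a b c (M : 'M[C]_(a, b)) (N : 'M[C]_(b, c)) :
  cstmx (M *m N) = cstmx M *m cstmx N.
Proof. exact: (map_mxM (@malgC (word g) C : {rmorphism C -> P})). Qed.

Lemma cstmxD a b (M N : 'M[C]_(a, b)) : cstmx (M + N) = cstmx M + cstmx N.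
Proof. exact: (map_mxD (@malgC (word g) C : {rmorphism C -> P})). Qed.

Lemma cstmx0 a b : cstmx (0 : 'M[C]_(a, b)) = 0.
Proof. exact: (map_mx0 (@malgC (word g) C : {rmorphism C -> P})). Qed.

Lemma cstmx_sum a b (I : Type) (r : seq I) (Q : pred I) (F : I -> 'M[C]_(a, b)) :
  cstmx (\sum_(i <- r | Q i) F i) = \sum_(i <- r | Q i) cstmx (F i).
Proof. exact: (big_morph _ (@cstmxD a b) (cstmx0 a b)). Qed.

Lemma starmx_cstmx a b (M : 'M[C]_(a, b)) : starmx (cstmx M) = cstmx (M^t*).
Proof.
apply/matrixP => i j; rewrite 3!mxE starU !mxE; congr (<< _ *g _ >>).
by apply: word_inj; rewrite star_wordE fm1.
Qed.

Lemma star_var (a : letter g) : star (var C a) = var C (star_letter a).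
Proof.
rewrite /var starU conjC1; congr (<< _ *g _ >>).
by apply: word_inj; rewrite star_wordE !fmU.
Qed.

Lemma mul_var_const (a : letter g) (c : C) : var C a * c%:MP = c *: var C a.
Proof.
rewrite -mul_malgC /var !mulUU mulr1 mul1r; congr (<< _ *g _ >>).
by rewrite mulm1 mul1m.
Qed.

Definition varmx n (a : letter g) : 'M[P]_n := (var C a)%:M.

Lemma cstmx_varmx m n a (M : 'M[C]_(m, n)) :
  cstmx M *m varmx n a = varmx m a *m cstmx M.
Proof.
apply/matrixP => i j; rewrite /varmx mul_scalar_mx [RHS]mxE [cstmx M i j]mxE.
rewrite mul_var_const mxE (bigD1 j) //= big1 ?addr0.
  by rewrite !mxE eqxx mulr1n mul_malgC.
by move=> k /negPf kj; rewrite [_%:M _ _]mxE kj mulr0n mulr0.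
Qed.

Lemma scalevarE m n (M : 'M[C]_(m, n)) a : scalevar M a = varmx m a *m cstmx M.
Proof.
by apply/matrixP => i j; rewrite /varmx mul_scalar_mx !mxE mul_var_const.
Qed.

Lemma starmx_varmx n a : starmx (varmx n a) = varmx n (star_letter a).
Proof.
apply/matrixP => i j; apply: etrans (mxE _ _ _ _) _.
have varmxE b i' j' : varmx n b i' j' = var C b *+ (i' == j') by rewrite mxE.
apply: etrans (congr1 _ (varmxE a j i)) _.
apply: etrans _ (esym (varmxE (star_letter a) i j)); rewrite (eq_sym j i).
by case: (i == j); [rewrite 2!mulr1n star_var | rewrite 2!mulr0n star0].
Qed.

Definition monomials D : 'M[P]_(nidx g nu D, nu) :=
  \matrix_(a, t) << (idx_col a == t)%:R *g xword (idx_word a) >>.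

Lemma cstmx_selmx_mul m n p (f : 'I_n -> 'I_m) (M : 'M[P]_(m, p)) a b :
  (cstmx (selmx C f)^T *m M) a b = M (f a) b.
Proof.
rewrite mxE (bigD1 (f a)) //= 3!mxE eqxx mul1r big1 ?addr0 // => c /negPf cf.
by rewrite 3!mxE cf mulr0n malgC0E mul0r.
Qed.

Lemma monomials_widen D : cstmx (selmx C (@widen g nu D))^T *m monomials D.+1 = monomials D.
Proof.
by apply/matrixP => a t; rewrite cstmx_selmx_mul [LHS]mxE [RHS]mxE idx_word_widen idx_col_widen.
Qed.

Lemma monomials_push D j :
  cstmx (selmx C (@push g nu D j))^T *m monomials D.+1 = varmx _ (inl j) *m monomials D.
Proof.
apply/matrixP => a t; rewrite cstmx_selmx_mul /varmx mul_scalar_mx !mxE idx_word_push idx_col_push.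
by rewrite mulUU mul1r xword_cons.
Qed.

(** The hereditary polynomial with Gram matrix H: the entry of H at (v, s), (w, t)
    is the coefficient of [v^* w] in the entry s, t. *)
Definition hpoly D (H : 'M[C]_(nidx g nu D)) : 'M[P]_nu :=
  starmx (monomials D) *m cstmx H *m monomials D.

Lemma hpoly_sum D (I : Type) (r : seq I) (F : I -> 'M[C]_(nidx g nu D)) :
  hpoly (\sum_(i <- r) F i) = \sum_(i <- r) hpoly (F i).
Proof. by rewrite /hpoly cstmx_sum mulmx_sumr mulmx_suml. Qed.

Lemma hpolyD D (M N : 'M[C]_(nidx g nu D)) : hpoly (M + N) = hpoly M + hpoly N.
Proof. by rewrite /hpoly cstmxD mulmxDr mulmxDl. Qed.

Local Notation iota := (selmx C (@widen g nu _)).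
Local Notation shift j := (selmx C (@push g nu _ j)).

Section Pencil.
Variables (l : nat) (A : 'I_g -> 'M[C]_l).

(** For F = F', the Gram matrix of [f^* L_A f] for the f with coefficients F: its
    middle factor [A_j x_j] shifts the words of the right-hand f, and
    [A_j^* x_j^*] those of the left-hand one, into degree D + 1.  Two arguments
    are kept because the duality theorem is about sesquilinear forms. *)
Definition pencil_form D (F F' : 'M[C]_(l, nidx g nu D)) : 'M[C]_(nidx g nu D.+1) :=
  iota *m (F^t* *m F') *m iota^T
  + \sum_j (iota *m (F^t* *m (A j *m F')) *m (shift j)^T
           + shift j *m (F^t* *m ((A j)^t* *m F')) *m iota^T).

Lemma starmx_monomials_widen D : starmx (monomials D.+1) *m cstmx iota = starmx (monomials D).
Proof.
rewrite -[in RHS]monomials_widen starmxM starmx_cstmx; congr (_ *m cstmx _).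
by rewrite -adj_selmx trmxCK.
Qed.

Lemma starmx_monomials_push D j : starmx (monomials D.+1) *m cstmx (shift j)
  = starmx (monomials D) *m varmx _ (inr j).
Proof.
rewrite -[inr j]/(star_letter (inl j)) -starmx_varmx -starmxM -monomials_push starmxM starmx_cstmx.
by congr (_ *m cstmx _); rewrite -adj_selmx trmxCK.
Qed.

Lemma hpoly_widen D (H : 'M[C]_(nidx g nu D)) :
  hpoly (iota *m H *m iota^T) = hpoly H.
Proof.
rewrite /hpoly cstmxM cstmxM mulmxA mulmxA starmx_monomials_widen -[LHS]mulmxA.
by rewrite monomials_widen.
Qed.

Lemma hpoly_widen_push D j (H : 'M[C]_(nidx g nu D)) :
  hpoly (iota *m H *m (shift j)^T)
  = starmx (monomials D) *m cstmx H *m (varmx _ (inl j) *m monomials D).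
Proof.
rewrite /hpoly cstmxM cstmxM mulmxA mulmxA starmx_monomials_widen -[LHS]mulmxA.
by rewrite monomials_push.
Qed.

Lemma hpoly_push_widen D j (H : 'M[C]_(nidx g nu D)) :
  hpoly (shift j *m H *m iota^T)
  = starmx (monomials D) *m varmx _ (inr j) *m cstmx H *m monomials D.
Proof.
rewrite /hpoly cstmxM cstmxM mulmxA mulmxA starmx_monomials_push -[LHS]mulmxA.
by rewrite monomials_widen.
Qed.

Lemma square_hpoly D (Q : 'M[C]_(l, nidx g nu D)) :
  starmx (cstmx Q *m monomials D) *m (cstmx Q *m monomials D) = hpoly (Q^t* *m Q).
Proof. by rewrite starmxM starmx_cstmx /hpoly cstmxM !mulmxA. Qed.

Lemma pencilE : pencil A =
  1%:M + \sum_j (varmx _ (inl j) *m cstmx (A j) + varmx _ (inr j) *m cstmx ((A j)^t*)).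
Proof.
rewrite /pencil -addrA; congr (_ + _); rewrite big_split /=.
by congr (_ + _); apply: eq_bigr => j _; rewrite scalevarE.
Qed.

(** The constants commute with the variable in the middle, which can therefore be
    absorbed by the monomials on its right if it is some [x_j], and on its left if
    it is some [x_j^*]. *)
Lemma pencil_hpoly D (F : 'M[C]_(l, nidx g nu D)) :
  starmx (cstmx F *m monomials D) *m pencil A *m (cstmx F *m monomials D) = hpoly (pencil_form F F).
Proof.
rewrite pencilE mulmxDr mulmxDl mulmx1 square_hpoly /pencil_form hpolyD hpoly_widen.
congr (_ + _); rewrite mulmx_sumr mulmx_suml hpoly_sum; apply: eq_bigr => j _.
rewrite mulmxDr mulmxDl hpolyD hpoly_widen_push hpoly_push_widen.
rewrite starmxM starmx_cstmx cstmxM cstmxM cstmxM cstmxM.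
congr (_ + _).
  by apply: mulmx_move_right; rewrite -cstmxM cstmx_varmx.
by apply: mulmx_move_left; exact: cstmx_varmx.
Qed.
End Pencil.
End Monomials.

(** * The truncated GNS construction *)

Lemma evalmx_pencil_herm (C : numClosedFieldType) g l n (A : 'I_g -> 'M[C]_l)
  (X : 'I_g -> 'M[C]_n) : (evalmx X (pencil A))^t* = evalmx X (pencil A).
Proof.
rewrite evalmx_pencil !adjmxD !adjmx_sum adjmx1 addrAC; congr (_ + _ + _).
  by apply: eq_bigr => j _; rewrite adjmx_tens !trmxCK.
by apply: eq_bigr => j _; rewrite adjmx_tens.
Qed.

Lemma pencil_quad (C : numClosedFieldType) g l n (A : 'I_g -> 'M[C]_l)
    (X : 'I_g -> 'M[C]_n) v (V := untensvec v) :
  (v^t* *m evalmx X (pencil A) *m v) 0 0 = \tr (V *m V^t*)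
    + \sum_j \tr (A j *m V *m (X j)^T *m V^t*)
    + \sum_j \tr ((A j)^t* *m V *m ((X j)^t*)^T *m V^t*).
Proof.
rewrite evalmx_pencil -[1%:M]tens11 !mulmxDr !mulmxDl ![(_ + _ : 'M__) 0 0]mxE.
rewrite !mulmx_sumr !mulmx_suml !summxE; congr (_ + _ + _).
- by rewrite tens_quad trmx1 mulmx1 mul1mx.
- by apply: eq_bigr => j _; rewrite tens_quad.
- by apply: eq_bigr => j _; rewrite tens_quad.
Qed.

Section GNS.
Variables (C : numClosedFieldType) (g nu l d : nat) (A : 'I_g -> 'M[C]_l).
Local Notation n := (nidx g nu d).
Local Notation iota := (selmx C (@widen g nu d)).
Local Notation shift j := (selmx C (@push g nu d j)).

Variable Y : 'M[C]_(nidx g nu d.+1).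
Hypothesis Y_herm : Y^t* = Y.

(** A functional on Gram matrices is H |-> tr (Y H).  [Ylow] is the inner product
    that it defines in degree at most d, and [Yshift j] pairs [x_j f], of degree at
    most d + 1, with the polynomials of degree at most d. *)
Definition Ylow : 'M[C]_n := iota^T *m Y *m iota.
Definition Yshift j : 'M[C]_n := (shift j)^T *m Y *m iota.

Lemma trace_pencil_form (F : 'M[C]_(l, n)) :
  \tr (Y *m pencil_form A F F) = \tr (F *m Ylow *m F^t*)
   + \sum_j (\tr (A j *m F *m Yshift j *m F^t*)
             + \tr ((A j)^t* *m F *m (Yshift j)^t* *m F^t*)).
Proof.
rewrite /pencil_form mulmxDr mulmx_sumr !raddfD /= raddf_sum /=.
have low (S U : 'M[C]_(nidx g nu d.+1, n)) (M : 'M_(n, l)) (N : 'M_(l, n)) :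
    \tr (Y *m (S *m (M *m N) *m U^T)) = \tr (N *m (U^T *m Y *m S) *m M).
  by rewrite mulmxA mxtrace_mulC !mulmxA mxtrace_mulC !mulmxA.
congr (_ + _); first by rewrite low.
apply: eq_bigr => j _; rewrite mulmxDr raddfD /= !low; congr (_ + _).
by rewrite /Yshift adjmxM adjmxM Y_herm adj_selmx adj_trselmx !mulmxA.
Qed.

Hypothesis Ylow_pd : forall v : 'rV[C]_n, v != 0 -> 0 < (v *m Ylow *m v^t*) 0 0.
Hypothesis Y_pencil : forall F : 'M[C]_(l, n), 0 <= \tr (Y *m pencil_form A F F).

Lemma Ylow_herm : Ylow^t* = Ylow.
Proof. by rewrite /Ylow adjmxM adjmxM Y_herm adj_selmx adj_trselmx mulmxA. Qed.

Section Tuple.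
Variable T : 'M[C]_n.
Hypotheses (Tunit : T \in unitmx) (YT : Ylow = T *m T^t*).

(** In the orthonormal coordinates given by the factor T of [Ylow], this is the
    operator that multiplies by [x_j] and projects back to degree at most d.  The
    transpose comes from the action V |-> A V X^T on arrays. *)
Definition gns_tuple j : 'M[C]_n := (invmx T *m Yshift j *m (invmx T)^t*)^T.

Lemma invmxT_adj : T^t* *m (invmx T)^t* = 1%:M.
Proof. by rewrite -adjmxM mulVmx // adjmx1. Qed.

Lemma invmxT_adj' : (invmx T)^t* *m T^t* = 1%:M.
Proof. by rewrite -adjmxM mulmxV // adjmx1. Qed.

(** At the array V = F T the quadratic form of the pencil is the value of the
    functional on [f^* L_A f], where f has coefficients F. *)
Lemma gns_in_spectrahedron : free_spectrahedron A gns_tuple.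
Proof.
rewrite /free_spectrahedron /=; split; first exact: evalmx_pencil_herm.
move=> v; pose V := untensvec v.
have [F VE] : exists F, V = F *m T.
  by exists (V *m invmx T); rewrite -mulmxA mulVmx // mulmx1.
have shiftE j (B : 'M_l) :
    \tr (B *m V *m (gns_tuple j)^T *m V^t*) = \tr (B *m F *m Yshift j *m F^t*).
  rewrite trmxK VE adjmxM; move: (Yshift j) => Z; rewrite !mulmxA.
  rewrite -(mulmxA (B *m F)) mulmxV // mulmx1.
  by rewrite -(mulmxA _ ((invmx T)^t*)) invmxT_adj' mulmx1.
have shiftE' j (B : 'M_l) :
    \tr (B *m V *m ((gns_tuple j)^t*)^T *m V^t*) = \tr (B *m F *m (Yshift j)^t* *m F^t*).
  have -> : ((gns_tuple j)^t*)^T = invmx T *m (Yshift j)^t* *m (invmx T)^t*.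
    have -> : ((gns_tuple j)^t*)^T = ((gns_tuple j)^T)^t* by rewrite map_trmx.
    by rewrite trmxK adjmxM adjmxM trmxCK mulmxA.
  rewrite VE; move: (Yshift j) => Z; rewrite adjmxM !mulmxA.
  rewrite -(mulmxA (B *m F)) mulmxV // mulmx1.
  by rewrite -(mulmxA _ ((invmx T)^t*)) invmxT_adj' mulmx1.
rewrite pencil_quad -/V.
rewrite (_ : _ + _ = \tr (Y *m pencil_form A F F)); first exact: Y_pencil.
rewrite trace_pencil_form big_split /= addrA; congr (_ + _ + _).
- by rewrite VE adjmxM YT !mulmxA.
- by apply: eq_bigr => j _; rewrite shiftE.
- by apply: eq_bigr => j _; rewrite shiftE'.
Qed.

(** The row of T with index (s, t) represents the monomial s in the column t.  The
    projection fixes [x_j] times a monomial of degree less than d. *)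
Lemma gns_orbit s t : (size s <= d)%N ->
  row (mkidx d [::] t) T *m (eval_word gns_tuple (xword s))^T = row (mkidx d s t) T.
Proof.
elim: s => [|j s IH] sd.
  by rewrite (_ : xword [::] = mone) ?eval_word1 ?trmx1 ?mulmx1 //;
    apply: word_inj; rewrite fm1.
have {}IH := IH (ltnW sd).
rewrite xword_cons eval_wordM trmx_mul mulmxA IH.
rewrite (@eval_wordE _ _ _ _ [:: inl j]) ?fmU //= mulmx1 trmxK.
rewrite -row_mul -(mulmxA (invmx T)) mulKVmx // row_mul.
have -> : row (mkidx d s t) (Yshift j) = row (mkidx d (j :: s) t) Ylow.
  apply/rowP => b; rewrite [LHS]mxE [RHS]mxE /Yshift /Ylow -!mulmxA.
  by rewrite !tr_selmx_mul push_mkidx.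
by rewrite YT row_mul -mulmxA invmxT_adj mulmx1.
Qed.

(** The test vector is made of the constants, which are the rows of T with the
    empty word.  By [gns_orbit] the monomials send it to T itself. *)
Lemma gns_eval (H : 'M[C]_n) :
  exists gam : 'cV[C]_(nu * n),
    (gam^t* *m evalmx gns_tuple (hpoly H) *m gam) 0 0 = \tr (Ylow *m H).
Proof.
pose Gam : 'M[C]_(nu, n) := \matrix_(t, a) T (mkidx d [::] t) a.
exists (tensvec Gam); pose om := evalmx gns_tuple (monomials C g nu d) *m tensvec Gam.
have omE : untensvec om = T.
  apply/matrixP => a b; rewrite mxE /om mxE sum_mxtens.
  rewrite (bigD1 (idx_col a)) //= [X in _ + X]big1 ?addr0; last first.
    move=> t ta; apply: big1 => c _; rewrite evalmxE mxE evalpU eq_sym (negPf ta).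
    by rewrite scale0r mxE mul0r.
  transitivity ((row (mkidx d [::] (idx_col a)) T *m
     (eval_word gns_tuple (xword (idx_word a)))^T) 0 b).
    rewrite mxE; apply: eq_bigr => c _; rewrite evalmxE mxE evalpU eqxx scale1r.
    by rewrite !mxE mxtens_indexK mulrC.
  by rewrite gns_orbit ?size_idx_word // mkidxK mxE.
rewrite /hpoly evalmxM evalmxM evalmx_star.
have -> : evalmx gns_tuple (cstmx g H) = H *t 1%:M.
  by apply: mxtensP => i j k m; rewrite evalmxE tensmxE mxE evalpU eval_word1 !mxE.
have -> : (tensvec Gam)^t* *m ((evalmx gns_tuple (monomials C g nu d))^t* *m (H *t 1%:M)
    *m evalmx gns_tuple (monomials C g nu d)) *m tensvec Gam = om^t* *m (H *t 1%:M) *m om.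
  by rewrite /om adjmxM !mulmxA.
by rewrite tens_quad omE trmx1 mulmx1 -mulmxA -YT mxtrace_mulC.
Qed.
End Tuple.

Lemma gns_positive (H : 'M[C]_n) :
  psd_on_spectrahedron A (hpoly H) -> 0 <= \tr (Ylow *m H).
Proof.
move=> hpsd; have [T Tunit YT] := pd_factor Ylow_herm Ylow_pd.
have [gam <-] := gns_eval Tunit YT H.
exact: (hpsd _ _ (gns_in_spectrahedron Tunit YT)).2.
Qed.
End GNS.

(** * A uniformly positive functional *)

Section Slater.
Variables (C : numClosedFieldType) (g nu l d : nat) (A : 'I_g -> 'M[C]_l).
Local Notation n := (nidx g nu d).
Local Notation n1 := (nidx g nu d.+1).

Definition sqnorm m p (M : 'M[C]_(m, p)) : C := \sum_i \sum_j `|M i j| ^+ 2.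

Lemma sqnorm_ge0 m p (M : 'M[C]_(m, p)) : 0 <= sqnorm M.
Proof. by apply: sumr_ge0 => i _; apply: sumr_ge0 => j _; rewrite exprn_ge0. Qed.

Lemma sqnorm_eq0 m p (M : 'M[C]_(m, p)) : sqnorm M <= 0 -> M = 0.
Proof.
move=> M0; have {M0} : sqnorm M == 0 by rewrite eq_le M0 sqnorm_ge0.
rewrite psumr_eq0 => [/allP Mi|i _]; last by apply: sumr_ge0 => j _; rewrite exprn_ge0.
apply/matrixP => i j; have := Mi i (mem_index_enum _); rewrite /= psumr_eq0.
  move=> /allP /(_ j (mem_index_enum _)); rewrite /= sqrf_eq0 normr_eq0.
  by rewrite mxE => /eqP.
by move=> k _; rewrite exprn_ge0.
Qed.

(** The bound c is uniform so that such a functional serves as the Slater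
    functional of the duality theorem. *)
Definition strictly_positive (c : C) (Y : 'M[C]_n1) : Prop :=
  [/\ Y^t* = Y,
      forall Q : 'M[C]_(l, n1), c * sqnorm Q <= \tr (Y *m (Q^t* *m Q))
    & forall F : 'M[C]_(l, n), c * sqnorm F <= \tr (Y *m pencil_form A F F)].

Lemma twice_Re_ge (z : C) : - (`|z| *+ 2) <= z + z^*.
Proof.
have zR : z + z^* \is Num.real by apply/CrealP; rewrite rmorphD /= conjCK addrC.
rewrite lerNl; apply: le_trans (_ : `|z + z^*| <= _).
  by rewrite -normrN; apply: real_ler_norm; rewrite realN.
by rewrite mulr2n -{2}(norm_conjC z) ler_normD.
Qed.

Lemma weighted_amgm (t x y : C) : 0 < t -> 0 <= x -> 0 <= y ->
  (x * y) *+ 2 <= t * y ^+ 2 + t^-1 * x ^+ 2.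
Proof.
move=> t0 x0 y0; rewrite -subr_ge0.
have -> : t * y ^+ 2 + t^-1 * x ^+ 2 - (x * y) *+ 2 = t^-1 * (x - t * y) ^+ 2.
  by field; rewrite gt_eqF.
by rewrite mulr_ge0 ?invr_ge0 ?(ltW t0)// real_exprn_even_ge0 // realB ?realM // ger0_real // ltW.
Qed.

Lemma trace_diag m p (D : 'rV[C]_p) (Q : 'M[C]_(m, p)) :
  \tr (Q *m diag_mx D *m Q^t*) = \sum_i \sum_b D 0 b * `|Q i b| ^+ 2.
Proof.
apply: eq_bigr => i _; rewrite mxE; apply: eq_bigr => b _.
by rewrite mul_mx_diag mxE adjmxE normCK mulrAC mulrC.
Qed.

Section Weight.
Variable t : C.
Hypothesis t0 : 0 < t.
(* With eta = t^2 both halves of the weighted inequality between the arithmetic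
   and geometric means, with weights t and 1/t, cost t times the norm below. *)
Let eta := t ^+ 2.
Definition weight D : 'rV[C]_(nidx g nu D) := \row_a eta ^+ size (idx_word a).

Lemma eta_gt0 : 0 < eta. Proof. by rewrite exprn_gt0. Qed.

Lemma Ylow_diag : Ylow (diag_mx (weight d.+1)) = diag_mx (weight d).
Proof.
apply/matrixP => a b; rewrite /Ylow mul_selmx tr_selmx_mul !mxE idx_word_widen.
by rewrite (inj_eq (@widen_inj _ _ _)).
Qed.

Lemma Yshift_diag j a b : Yshift (diag_mx (weight d.+1)) j a b =
  eta ^+ size (idx_word b) *+ (push j a == widen b).
Proof.
rewrite /Yshift mul_selmx tr_selmx_mul !mxE.
by case: eqP => [->|//]; rewrite idx_word_widen.
Qed.

Definition wsqnorm (F : 'M[C]_(l, n)) := \sum_i \sum_b eta ^+ size (idx_word b) * `|F i b| ^+ 2.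

Lemma wterm_ge0 (F : 'M[C]_(l, n)) i b : 0 <= eta ^+ size (idx_word b) * `|F i b| ^+ 2.
Proof. by rewrite mulr_ge0 ?exprn_ge0 // ltW // eta_gt0. Qed.

Lemma wsqnorm_row (F : 'M[C]_(l, n)) i :
  \sum_b eta ^+ size (idx_word b) * `|F i b| ^+ 2 <= wsqnorm F.
Proof.
rewrite /wsqnorm (bigD1 i) //= lerDl sumr_ge0 // => k _.
by rewrite sumr_ge0 // => b _; exact: wterm_ge0.
Qed.

Lemma le1_card_sum (I : finType) (Q : pred I) :
  (forall a b, Q a -> Q b -> a = b) -> \sum_a (Q a)%:R <= 1 :> C.
Proof.
move=> Q1; case: (pickP Q) => [a Qa|Q0]; last by rewrite big1 ?ler01 // => a _; rewrite Q0.
rewrite (bigD1 a) //= Qa big1 ?addr0 // => b ba.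
by case: (boolP (Q b)) => // Qb; rewrite (Q1 _ _ Qa Qb) eqxx in ba.
Qed.

Lemma push_inj j : injective (@push g nu d j).
Proof.
move=> a b E; apply: idx_inj; last by rewrite -(idx_col_push j a) E idx_col_push.
by have := idx_word_push j a; rewrite E idx_word_push => -[].
Qed.

(** Every word is the shift of at most one word, and is shifted to at most one
    word, so after separating the two factors each sum is at most the weighted
    norm; passing from a word to its shift costs one factor eta. *)
Lemma cross_bound (F : 'M[C]_(l, n)) j i k :
  \sum_a \sum_b (eta ^+ size (idx_word b) *+ (push j a == widen b)) *
     ((`|F k a| * `|F i b|) *+ 2) <= (t * wsqnorm F) *+ 2.
Proof.
have pos b : 0 <= eta ^+ size (idx_word (b : 'I_n)) by rewrite exprn_ge0 // ltW // eta_gt0.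
pose S1 := \sum_b (t * (eta ^+ size (idx_word b) * `|F i b| ^+ 2)) *
    \sum_a (push j a == widen b)%:R.
pose S2 := \sum_a (t * (eta ^+ size (idx_word a) * `|F k a| ^+ 2)) *
    \sum_b (push j a == widen b)%:R.
apply: (@le_trans _ _ (S1 + S2)).
  rewrite /S1 /S2; under [X in _ <= X + _]eq_bigr do rewrite mulr_sumr.
  under [X in _ <= _ + X]eq_bigr do rewrite mulr_sumr.
  rewrite exchange_big [X in _ <= X + _]exchange_big /= -big_split /=.
  rewrite exchange_big; apply: ler_sum => a _.
  rewrite -big_split /=; apply: ler_sum => b _.
  case: eqP => [E|_]; last by rewrite mulr0n mul0r !mulr0 addr0.
  rewrite !mulr1 mulr1n; have := weighted_amgm t0 (normr_ge0 (F k a)) (normr_ge0 (F i b)).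
  move=> /(ler_wpM2l (pos b)) /le_trans; apply.
  have -> : eta ^+ size (idx_word b) = eta ^+ size (idx_word a) * eta.
    by rewrite -exprSr -(idx_word_widen b) -E idx_word_push.
  rewrite le_eqVlt; apply/orP; left; apply/eqP; rewrite /eta.
  by field; rewrite gt_eqF.
have bnd (G : 'M[C]_(l, n)) i' (N : 'I_n -> C) : (forall b, 0 <= N b <= 1) ->
    \sum_b (t * (eta ^+ size (idx_word b) * `|G i' b| ^+ 2)) * N b <= t * wsqnorm G.
  move=> N01; apply: le_trans (_ : t * \sum_b eta ^+ size (idx_word b) * `|G i' b| ^+ 2 <= _).
    rewrite mulr_sumr; apply: ler_sum => b _; have /andP[N0 N1] := N01 b.
    by rewrite ler_piMr // mulr_ge0 ?(ltW t0) // wterm_ge0.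
  by rewrite ler_pM2l // wsqnorm_row.
rewrite mulr2n; apply: lerD; apply: bnd => b; rewrite sumr_ge0 ?le1_card_sum //=.
- by move=> a a' /eqP Ea /eqP Ea'; apply: (@push_inj j); rewrite Ea Ea'.
- by move=> a a' /eqP Ea /eqP Ea'; apply: (@widen_inj g nu d); rewrite -Ea -Ea'.
Qed.

Lemma cross_term (F : 'M[C]_(l, n)) (B : 'M[C]_l) (Z : 'M[C]_n) :
  \tr (B *m F *m Z *m F^t*) =
  \sum_i \sum_k \sum_a \sum_b B i k * Z a b * (F k a * (F i b)^*).
Proof.
apply: eq_bigr => i _; rewrite exchange_big /=.
under [RHS]eq_bigr do rewrite exchange_big /=.
rewrite exchange_big mxE; apply: eq_bigr => b _.
rewrite mxE mulr_suml; apply: eq_bigr => a _.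
rewrite mxE !mulr_suml; apply: eq_bigr => k _.
by rewrite adjmxE; ring.
Qed.

Definition coef_mass : C := \sum_j \sum_i \sum_k `|A j i k|.

Lemma coef_mass_ge0 : 0 <= coef_mass.
Proof. by do 3![apply: sumr_ge0 => ? _]. Qed.

Lemma cross_lower (F : 'M[C]_(l, n)) j :
  - (\sum_i \sum_k `|A j i k| * ((t * wsqnorm F) *+ 2)) <=
  \tr (A j *m F *m Yshift (diag_mx (weight d.+1)) j *m F^t*)
  + \tr ((A j)^t* *m F *m (Yshift (diag_mx (weight d.+1)) j)^t* *m F^t*).
Proof.
set Z := Yshift _ _; set x := \tr (A j *m _ *m _ *m _).
have -> : \tr ((A j)^t* *m F *m Z^t* *m F^t*) = x^*.
  exact: cross_adj.
apply: le_trans (twice_Re_ge x); rewrite lerN2 /x cross_term.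
apply: (@le_trans _ _ ((\sum_i \sum_k \sum_a \sum_b
    `|A j i k| * (Z a b * (`|F k a| * `|F i b|))) *+ 2)).
  have Z0 a b : 0 <= Z a b.
    by rewrite Yshift_diag mulrn_wge0 ?exprn_ge0 // ltW ?eta_gt0.
  rewrite lerMn2r /=; apply: le_trans (ler_norm_sum _ _ _) _; apply: ler_sum => i _.
  apply: le_trans (ler_norm_sum _ _ _) _; apply: ler_sum => k _.
  apply: le_trans (ler_norm_sum _ _ _) _; apply: ler_sum => a _.
  apply: le_trans (ler_norm_sum _ _ _) _; apply: ler_sum => b _.
  by rewrite !normrM norm_conjC (ger0_norm (Z0 a b)) -!mulrA.
rewrite -sumrMnl; apply: ler_sum => i _; rewrite -sumrMnl; apply: ler_sum => k _.
apply: le_trans (ler_wpM2l (normr_ge0 (A j i k)) (cross_bound F j i k)).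
rewrite le_eqVlt; apply/orP; left; apply/eqP.
rewrite -sumrMnl mulr_sumr; apply: eq_bigr => a _.
rewrite -sumrMnl mulr_sumr; apply: eq_bigr => b _.
by rewrite Yshift_diag -!mulrnAr.
Qed.

Lemma diag_herm m (u : 'rV[C]_m) : (forall i, 0 <= u 0 i) -> (diag_mx u)^t* = diag_mx u.
Proof.
move=> u0; apply/matrixP => i j; rewrite !mxE eq_sym.
by case: eqP => [->|_]; rewrite ?mulr0n ?conjC0 // mulr1n conj_Creal ?ger0_real.
Qed.

Lemma weight_ge0 D i : 0 <= weight D 0 i.
Proof. by rewrite mxE exprn_ge0 // ltW ?eta_gt0. Qed.

(** The cross terms take away at most half of the diagonal part. *)
Lemma pencil_lower (F : 'M[C]_(l, n)) : (t * coef_mass) *+ 4 <= 1 ->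
  2^-1 * wsqnorm F <= \tr (diag_mx (weight d.+1) *m pencil_form A F F).
Proof.
move=> small; have Yherm := diag_herm (@weight_ge0 d.+1).
rewrite trace_pencil_form // Ylow_diag trace_diag.
have -> : \sum_i \sum_b weight d 0 b * `|F i b| ^+ 2 = wsqnorm F.
  by apply: eq_bigr => i _; apply: eq_bigr => b _; rewrite mxE.
apply: (@le_trans _ _ (wsqnorm F - \sum_j \sum_i \sum_k `|A j i k| * ((t * wsqnorm F) *+ 2))).
  under eq_bigr do under eq_bigr do rewrite -mulr_suml.
  under eq_bigr do rewrite -mulr_suml.
  rewrite -mulr_suml -/coef_mass.
  have N0 : 0 <= wsqnorm F by do 2![apply: sumr_ge0 => ? _]; exact: wterm_ge0.
  rewrite -subr_ge0.
  have -> : wsqnorm F - coef_mass * (t * wsqnorm F *+ 2) - 2^-1 * wsqnorm F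
     = 2^-1 * wsqnorm F * (1 - (t * coef_mass) *+ 4) by field.
  by rewrite mulr_ge0 ?subr_ge0 // mulr_ge0 // invr_ge0.
rewrite lerD2l -sumrN; apply: ler_sum => j _; exact: cross_lower.
Qed.
End Weight.

(** The weights decrease so fast with the degree that the cross terms, which relate
    consecutive degrees, are dominated; t is chosen for [pencil_lower]. *)
Lemma strictly_positive_exists : exists c Y0, 0 < c /\ strictly_positive c Y0.
Proof.
have m0 := coef_mass_ge0.
have t0 : 0 < ((coef_mass + 1) *+ 4)^-1 :> C by rewrite invr_gt0 pmulrn_lgt0 // ltr_wpDl.
set t := _^-1 in t0; pose eta := t ^+ 2.
have eta0 : 0 < eta by rewrite exprn_gt0.
have small : (t * coef_mass) *+ 4 <= 1.
  rewrite -mulrnAr /t mulrC ler_pdivrMr ?pmulrn_lgt0 ?ltr_wpDl //.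
  by rewrite mul1r lerMn2r lerDl ler01.
have eta1 : eta <= 1.
  rewrite exprn_ile1 ?(ltW t0) // invf_le1 ?pmulrn_lgt0 ?ltr_wpDl //.
  by rewrite mulrS ler_wpDr ?mulrn_wge0 ?addr_ge0 // lerDr.
exists (2^-1 * eta ^+ d.+1), (diag_mx (weight t d.+1)).
have low (m D : nat) (M : 'M[C]_(m, nidx g nu D)) : (D <= d.+1)%N ->
    eta ^+ d.+1 * sqnorm M <= \sum_i \sum_b eta ^+ size (idx_word b) * `|M i b| ^+ 2.
  move=> Dd; rewrite mulr_sumr; apply: ler_sum => i _; rewrite mulr_sumr.
  apply: ler_sum => b _; rewrite ler_wpM2r ?exprn_ge0 //.
  by rewrite ler_wiXn2l ?(ltW eta0) // (leq_trans (size_idx_word b)).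
have half (M : C) : 0 <= M -> 2^-1 * M <= M.
  by move=> M0; rewrite ler_piMl // invf_le1 ?ler1n ?ltr0n.
split; first by rewrite mulr_gt0 ?invr_gt0 ?exprn_gt0.
split=> [|Q|F].
- exact/diag_herm/weight_ge0.
- rewrite mulmxA mxtrace_mulC mulmxA trace_diag -mulrA.
  apply: le_trans (half _ _) _; first by rewrite mulr_ge0 ?sqnorm_ge0 ?exprn_ge0 ?ltW.
  apply: le_trans (low _ _ Q _) _ => //.
  by rewrite le_eqVlt; apply/orP; left; apply/eqP/eq_bigr => i _;
    apply: eq_bigr => b _; rewrite mxE.
- apply: le_trans (pencil_lower t0 F small); rewrite -mulrA ler_pM2l ?invr_gt0 //.
  exact: low.
Qed.
End Slater.

(** * Certificates from positive functionals *)
Lemma no_perturbation (R : realType) (s w : R) :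
  s < 0 -> (forall e, 0 < e -> 0 <= s + e * w) -> False.
Proof.
move=> s0 pos; have w0 := normr_ge0 w; have ww := ler_norm w.
have den : 0 < 2 * (`|w| + 1) by lra.
have e0 : 0 < - s / (2 * (`|w| + 1)) by rewrite divr_gt0 // oppr_gt0.
have := pos _ e0; set e := _ / _ in e0 *.
have eE : e * (2 * (`|w| + 1)) = - s by rewrite /e divfK // gt_eqF.
by nra.
Qed.

Section Certificate.
Variables (R : realType) (g nu l d : nat).
Local Notation C := (complex R).
Local Notation re := (@complex.Re R).
Variable A : 'I_g -> 'M[C]_l.
Local Notation n := (nidx g nu d).
Local Notation n1 := (nidx g nu d.+1).
Local Notation iota := (selmx C (@widen g nu d)).

Lemma normsqE (z : C) : `|z| ^+ 2 = (nsq z)%:C%C.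
Proof.
rewrite normCK; case: z => x y; apply/eqP; rewrite eq_complex /nsq /=.
by apply/andP; split; apply/eqP; ring.
Qed.

Lemma ge0_re (z : C) : 0 <= z -> 0 <= re z.
Proof. by case: z => x y; rewrite lecE /= => /andP[]. Qed.

Lemma le_re (z w : C) : z <= w -> re z <= re w.
Proof. by rewrite -subr_ge0 => /ge0_re; rewrite reD reN subr_ge0. Qed.

(** Duality provides a functional that is controlled only through its real part;
    on Hermitian matrices this real part is the functional given here. *)
Definition hermitian_part m (M : 'M[C]_m) : 'M[C]_m := 2^-1 *: (M + M^t*).

Lemma hermitian_part_herm m (M : 'M[C]_m) : (hermitian_part M)^t* = hermitian_part M.
Proof.
rewrite /hermitian_part adjmxZ adjmxD trmxCK addrC; congr (_ *: _).
by rewrite conj_Creal // realV realn.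
Qed.

Lemma trace_hermitian_part m (M N : 'M[C]_m) : N^t* = N ->
  \tr (hermitian_part M *m N) = (re (\tr (M *m N)))%:C%C.
Proof.
move=> NH; rewrite /hermitian_part -scalemxAl mulmxDl mxtraceZ mxtraceD.
have -> : \tr (M^t* *m N) = (\tr (M *m N))^*.
  by rewrite -mxtrace_adj adjmxM NH mxtrace_mulC.
have -> : (2^-1 : C) = (2^-1 : R)%:C%C by rewrite fmorphV rmorph_nat.
case: (\tr _) => x y; apply/eqP; rewrite eq_complex /=.
by apply/andP; split; apply/eqP => /=; field.
Qed.

Section Sesqui.

(** A vector encodes one analytic polynomial to be squared, of degree at most
    d + 1, and one to be put around the pencil, of degree at most d. *)
Definition square_part (z : 'rV[C]_(l * n1 + l * n)) : 'M[C]_(l, n1) := vec_mx (lsubmx z).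
Definition pencil_part (z : 'rV[C]_(l * n1 + l * n)) : 'M[C]_(l, n) := vec_mx (rsubmx z).

Definition cert_form z z' : 'M[C]_n1 :=
  (square_part z)^t* *m square_part z' + pencil_form A (pencil_part z) (pencil_part z').

Lemma pencil_formDr (F G H : 'M[C]_(l, n)) a :
  pencil_form A F (a *: G + H) = a *: pencil_form A F G + pencil_form A F H.
Proof.
rewrite /pencil_form scalerDr scaler_sumr addrACA; congr (_ + _).
  by rewrite mulmxDr -scalemxAr mulmxDr mulmxDl -scalemxAr -scalemxAl.
rewrite -big_split; apply: eq_bigr => j _ /=.
rewrite scalerDr addrACA; congr (_ + _).
  by rewrite !(mulmxDr, mulmxDl) -!(scalemxAr, scalemxAl).
by rewrite !(mulmxDr, mulmxDl) -!(scalemxAr, scalemxAl).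
Qed.

Lemma pencil_form0 : pencil_form A (0 : 'M[C]_(l, n)) 0 = 0.
Proof.
rewrite /pencil_form adjmx0 mul0mx mulmx0 mul0mx add0r big1 // => j _.
by rewrite !mul0mx !mulmx0 !mul0mx addr0.
Qed.

Lemma pencil_form_adj (F G : 'M[C]_(l, n)) :
  (pencil_form A F G)^t* = pencil_form A G F.
Proof.
rewrite /pencil_form adjmxD adjmx_sum; congr (_ + _).
  by rewrite adjmxM adjmxM adj_trselmx adj_selmx adjmxM trmxCK mulmxA.
apply: eq_bigr => j _; rewrite adjmxD addrC; congr (_ + _).
  by rewrite adjmxM adjmxM adj_trselmx adj_selmx adjmxM adjmxM !trmxCK !mulmxA.
by rewrite adjmxM adjmxM adj_trselmx adj_selmx adjmxM adjmxM trmxCK !mulmxA.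
Qed.

Lemma square_partP a u u' : square_part (a *: u + u') = a *: square_part u + square_part u'.
Proof. by apply/matrixP => i j; rewrite !mxE. Qed.

Lemma pencil_partP a u u' : pencil_part (a *: u + u') = a *: pencil_part u + pencil_part u'.
Proof. by apply/matrixP => i j; rewrite !mxE. Qed.

Lemma cert_formDr z a u u' : cert_form z (a *: u + u') = a *: cert_form z u + cert_form z u'.
Proof.
rewrite /cert_form square_partP pencil_partP pencil_formDr mulmxDr -scalemxAr.
by rewrite addrACA -scalerDr.
Qed.

Lemma cert_form_adj z u : (cert_form z u)^t* = cert_form u z.
Proof. by rewrite /cert_form adjmxD pencil_form_adj adjmxM trmxCK. Qed.

Lemma cert_form_sesqui a b : sesquilinear (fun z u => cert_form z u a b).
Proof.
have adj z u : cert_form z u a b = (cert_form u z b a)^*.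
  by rewrite -(cert_form_adj u z) adjmxE.
have entry (M N : 'M[C]_n1) x i j : (x *: M + N) i j = x * M i j + N i j.
  by rewrite !mxE.
split=> x z z' u; last by rewrite cert_formDr entry.
apply: etrans (adj _ _) _; rewrite cert_formDr entry.
apply: etrans (rmorphD _ _ _) _; congr (_ + _); last exact/esym/adj.
by apply: etrans (rmorphM _ _ _) _; congr (_ * _); exact/esym/adj.
Qed.

Lemma cert_norm z : sqnorm (square_part z) + sqnorm (pencil_part z) = (\sum_i nsq (z 0 i))%:C%C.
Proof.
have fro_vec p q (v : 'rV[C]_(p * q)) : sqnorm (vec_mx v : 'M_(p, q)) = \sum_i `|v 0 i| ^+ 2.
  rewrite (reindex _ (curry_mxvec_bij _ _)) /= /sqnorm pair_big /=.
  by apply: eq_bigr => -[i j] _; rewrite mxE.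
rewrite !fro_vec big_split_ord rmorphD !rmorph_sum /=.
by congr (_ + _); apply: eq_bigr => i _; rewrite mxE normsqE.
Qed.
End Sesqui.

Lemma reZ (e : R) (z : C) : re (e%:C%C * z) = e * re z.
Proof. by case: z => x y /=; ring. Qed.

Lemma re_trace_perturb m (Y Z M : 'M[C]_m) e :
  re (\tr ((Y + e%:C%C *: Z) *m M)) = re (\tr (Y *m M)) + e * re (\tr (Z *m M)).
Proof. by rewrite mulmxDl mxtraceD -scalemxAl mxtraceZ reD reZ. Qed.

Lemma trace_pairing m (y : 'I_m * 'I_m -> C) (M : 'M[C]_m) :
  \sum_k y k * M k.1 k.2 = \tr ((\matrix_(b, a) y (a, b)) *m M).
Proof.
transitivity (\sum_a \sum_b y (a, b) * M a b).
  by rewrite pair_big; apply: eq_bigr => -[].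
rewrite exchange_big; apply: eq_bigr => b _; rewrite mxE.
by apply: eq_bigr => a _; rewrite mxE.
Qed.

(** Each row of B contributes one square and one pencil term. *)
Definition certificate (H : 'M[C]_n) : Prop :=
  exists B : 'M[C]_((l * n1 + l * n).+1, l * n1 + l * n),
    iota *m H *m iota^T = \sum_r cert_form (row r B) (row r B).

(** A functional that separates H from the cone of certificates stays negative at H
    after a small multiple of the Slater functional is added, which makes it
    strictly positive. *)
Lemma certificate_of_positive (H : 'M[C]_n) : H^t* = H ->
  (forall c Y, 0 < c -> strictly_positive A c Y -> 0 <= re (\tr (Ylow Y *m H))) ->
  certificate H.
Proof.
move=> HH Hpos; have [c [Y0 [c0 Y0pos]]] := strictly_positive_exists nu d A.
have cE : c = (re c)%:C%C by move: c0; case: (c) => x y; rewrite ltcE /= => /andP[/eqP -> _].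
have rc0 : 0 < re c by rewrite -ltcR -cE.
have liftH Y : \tr (Ylow Y *m H) = \tr (Y *m (iota *m H *m iota^T)).
  by rewrite /Ylow mulmxA [RHS]mxtrace_mulC !mulmxA.
have [|//||[B Bb]|[y [ypos yneg]]] :=
  @sesqui_farkas R ('I_n1 * 'I_n1)%type _
    (fun k z u => cert_form z u k.1 k.2)
    (fun k => (iota *m H *m iota^T) k.1 k.2)
    (fun k => Y0 k.2 k.1) (re c).
- by move=> k; exact: cert_form_sesqui.
- move=> z; rewrite (trace_pairing (fun k => Y0 k.2 k.1) (cert_form z z)).
  have -> : \matrix_(b, a) Y0 (a, b).2 (a, b).1 = Y0 by apply/matrixP => i j; rewrite mxE.
  have [_ Q0 F0] := Y0pos.
  have : c * (sqnorm (square_part z) + sqnorm (pencil_part z)) <= \tr (Y0 *m cert_form z z).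
    by rewrite mulrDr mulmxDr mxtraceD lerD.
  by rewrite cert_norm cE -rmorphM /= => /le_re.
- exists B; apply/matrixP => a b; rewrite -(Bb (a, b)) /gram summxE.
  by [].
exfalso.
have [Yh [YhH YhE]] : exists Yh : 'M[C]_n1, Yh^t* = Yh /\
    forall M, M^t* = M -> \tr (Yh *m M) = (re (\sum_k y k * M k.1 k.2))%:C%C.
  exists (hermitian_part (\matrix_(b, a) y (a, b))); split; first exact: hermitian_part_herm.
  by move=> M MH; rewrite trace_hermitian_part // trace_pairing.
have s0 : re (\tr (Ylow Yh *m H)) < 0.
  by rewrite liftH YhE // adjmxM adjmxM adj_trselmx adj_selmx HH mulmxA.
have Yh_cert z : 0 <= \tr (Yh *m cert_form z z) by rewrite YhE ?cert_form_adj // lecR.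
have pos e : 0 < e -> 0 <= re (\tr (Ylow Yh *m H)) + e * re (\tr (Ylow Y0 *m H)).
  move=> e0.
  rewrite (liftH Yh) (liftH Y0) -re_trace_perturb -liftH.
  apply: (Hpos (e%:C%C * c)); first by rewrite mulr_gt0 // ltcR.
  have [Y0H Q0 F0] := Y0pos; have e0' : 0 <= e%:C%C by rewrite lecR ltW.
  split=> [|Q|F].
  - by rewrite adjmxD adjmxZ YhH Y0H conj_Creal // ger0_real.
  - rewrite mulmxDl mxtraceD -scalemxAl mxtraceZ -mulrA ler_wpDl ?ler_wpM2l //.
    have := Yh_cert (row_mx (mxvec Q) 0); rewrite /cert_form /square_part /pencil_part.
    rewrite row_mxKl row_mxKr mxvecK linear0.
    by rewrite pencil_form0 addr0.
  - rewrite mulmxDl mxtraceD -scalemxAl mxtraceZ -mulrA ler_wpDl ?ler_wpM2l //.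
    have := Yh_cert (row_mx 0 (mxvec F)); rewrite /cert_form /square_part /pencil_part.
    by rewrite row_mxKl row_mxKr mxvecK linear0 mulmx0 add0r.
exact: no_perturbation s0 pos.
Qed.
End Certificate.

(** * Positivity on the spectrahedron gives a certificate *)

Section Positivity.
Variables (R : realType) (g nu l d : nat).
Local Notation C := (complex R).
Local Notation re := (@complex.Re R).
Variable A : 'I_g -> 'M[C]_l.
Hypothesis l_gt0 : (0 < l)%N.
Local Notation n := (nidx g nu d).
Local Notation n1 := (nidx g nu d.+1).
Local Notation iota := (selmx C (@widen g nu d)).

Lemma iotaK : iota^T *m iota = 1%:M.
Proof.
apply/matrixP => a b; rewrite tr_selmx_mul !mxE.
by rewrite (inj_eq (@widen_inj g nu d)).
Qed.

(** A vector is put in the first row of the coefficients of a square; such a row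
    exists because 0 < l. *)
Lemma strictly_positive_pd c Y : 0 < c -> strictly_positive A c Y ->
  forall v : 'rV[C]_n, v != 0 -> 0 < (v *m Ylow Y *m v^t*) 0 0.
Proof.
move=> c0 [_ Ypos _] v v0; pose u := v *m iota^T.
pose e : 'cV[C]_l := delta_mx (Ordinal l_gt0) 0.
have ee : e^t* *m e = 1%:M.
  apply/matrixP => i j; rewrite !ord1 mxE (bigD1 (Ordinal l_gt0)) //= big1 ?addr0.
    by rewrite !mxE !eqxx conjC1 mulr1.
  by move=> k /negPf k0; rewrite !mxE k0 conjC0 mul0r.
have uE : v = (e^t* *m (e *m u)) *m iota.
  by rewrite mulmxA ee mul1mx /u -mulmxA iotaK mulmx1.
have fro_pos : 0 < sqnorm (e *m u).
  rewrite lt_def sqnorm_ge0 andbT; apply: contraNneq v0 => f0.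
  by rewrite uE (sqnorm_eq0 (_ : sqnorm (e *m u) <= 0)) ?mulmx0 ?mul0mx // f0.
have := Ypos (e *m u); rewrite adjmxM -mulmxA (mulmxA (e^t*)) ee mul1mx.
have -> : \tr (Y *m (u^t* *m u)) = (v *m Ylow Y *m v^t*) 0 0.
  rewrite mulmxA mxtrace_mulC mulmxA /Ylow /u adjmxM adj_trselmx.
  by rewrite /mxtrace big_ord1 !mulmxA.
by apply: lt_le_trans; rewrite mulr_gt0.
Qed.

Lemma trace_hermitian_part_r m (Y M : 'M[C]_m) : Y^t* = Y ->
  \tr (Y *m hermitian_part M) = (re (\tr (Y *m M)))%:C%C.
Proof. by move=> YH; rewrite mxtrace_mulC trace_hermitian_part // mxtrace_mulC. Qed.

(** The skew part K of H pairs to 0 with every strictly positive functional, so it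
    has a certificate by [certificate_of_positive].  Uniform positivity of the
    Slater functional, which also vanishes at K, makes all terms of that
    certificate vanish. *)
Lemma psd_hermitian (H : 'M[C]_n) :
  (forall c Y, 0 < c -> strictly_positive A c Y -> 0 <= \tr (Ylow Y *m H)) ->
  H^t* = H.
Proof.
move=> Hpos; pose j : C := (0 +i* 1)%C; pose K := hermitian_part (j *: H).
have K0 c Y : 0 < c -> strictly_positive A c Y -> \tr (Ylow Y *m K) = 0.
  move=> c0 Ypos; rewrite trace_hermitian_part_r; last by case: Ypos => YH _ _; exact: Ylow_herm.
  rewrite -scalemxAr mxtraceZ; have := Hpos c Y c0 Ypos.
  case: (\tr _) => x y; rewrite lecE /= => /andP[/eqP -> _].
  by rewrite mul0r mulr0 subr0.
have [B KB] : certificate A K.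
  apply: certificate_of_positive (hermitian_part_herm _) _ => c Y c0 Ypos.
  by rewrite (K0 c Y).
have [c [Y0 [c0 Y0pos]]] := strictly_positive_exists nu d A.
have cert_ge z : c * (sqnorm (square_part z) + sqnorm (pencil_part z))
    <= \tr (Y0 *m cert_form A z z).
  by have [_ Q0 F0] := Y0pos; rewrite mulrDr mulmxDr mxtraceD lerD.
have cert0 : iota *m K *m iota^T = 0.
  rewrite KB big1 // => r _; pose z := row r B.
  have : c * (sqnorm (square_part z) + sqnorm (pencil_part z)) <= 0.
    apply: le_trans (cert_ge z) _.
    have : \tr (Y0 *m (iota *m K *m iota^T)) = 0.
      rewrite -(K0 c Y0 c0 Y0pos) /Ylow mulmxA [LHS]mxtrace_mulC.
      by rewrite !mulmxA.
    rewrite KB mulmx_sumr raddf_sum /= (bigD1 r) //= => E.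
    rewrite -E lerDl sumr_ge0 // => s _; apply: le_trans (cert_ge _).
    by rewrite mulr_ge0 ?addr_ge0 ?sqnorm_ge0 // ltW.
  rewrite pmulr_rle0 // => zz.
  have sq0 : square_part z = 0.
    by apply: sqnorm_eq0; apply: le_trans zz; rewrite lerDl sqnorm_ge0.
  have l0 : pencil_part z = 0.
    by apply: sqnorm_eq0; apply: le_trans zz; rewrite lerDr sqnorm_ge0.
  by rewrite /cert_form sq0 l0 pencil_form0 mulmx0 addr0.
have {cert0} : K = 0.
  have <- : iota^T *m (iota *m K *m iota^T) *m iota = K.
    by rewrite !mulmxA iotaK mul1mx -mulmxA iotaK mulmx1.
  by rewrite cert0 mulmx0 mul0mx.
rewrite /K /hermitian_part adjmxZ => /eqP; rewrite scaler_eq0 invr_eq0 pnatr_eq0 /=.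
have -> : j^* = - j by rewrite /j; apply/eqP; rewrite eq_complex /= oppr0 !eqxx.
have j0 : j != 0 by rewrite eq_complex /= oner_eq0 andbF.
by rewrite scaleNr subr_eq0 => /eqP /(scalerI j0) /esym.
Qed.

Lemma psd_certificate (H : 'M[C]_n) :
  psd_on_spectrahedron A (hpoly H) -> certificate A H.
Proof.
move=> Hpsd.
have Hpos c Y : 0 < c -> strictly_positive A c Y -> 0 <= \tr (Ylow Y *m H).
  move=> c0 Ypos; have Ypd := strictly_positive_pd c0 Ypos.
  case: Ypos => YH _ YF; apply: (gns_positive YH Ypd _ Hpsd) => F.
  by apply: le_trans (YF F); rewrite mulr_ge0 ?sqnorm_ge0 // ltW.
apply: certificate_of_positive (psd_hermitian Hpos) _ => c Y c0 Ypos.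
exact: ge0_re (Hpos c Y c0 Ypos).
Qed.
End Positivity.

(** * Hereditary polynomials of bounded degree *)

Section Hereditary.
Variables (C : numClosedFieldType) (g nu d : nat).
Local Notation P := (ncpoly C g).

Definition hereditary_of (v w : seq 'I_g) : word g := mmul (star_word (xword v)) (xword w).

Lemma hereditary_ofE v w : hereditary_of v w = map inr (rev v) ++ map inl w :> seq (letter g).
Proof. by rewrite fmM star_wordE -map_comp -map_rev. Qed.

(** The letters with a star come first, so the two halves can be told apart. *)
Lemma hereditary_of_inj v w v' w' : hereditary_of v w = hereditary_of v' w' -> v = v' /\ w = w'.
Proof.
move=> E; have : map inr (rev v) ++ map inl w = map inr (rev v') ++ map inl w' :> seq (letter g).
  by rewrite -!hereditary_ofE E.
pose lf (a : letter g) := if a is inl j then Some j else None.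
pose rt (a : letter g) := if a is inr j then Some j else None.
have lfl s : pmap lf (map inl s) = s by elim: s => //= j s ->.
have lfr s : pmap lf (map inr s) = [::] by elim: s.
have rtl s : pmap rt (map inl s) = [::] by elim: s.
have rtr s : pmap rt (map inr s) = s by elim: s => //= j s ->.
move=> {}E; split.
  by have := congr1 (pmap rt) E; rewrite !pmap_cat !rtl !rtr !cats0 => /(congr1 rev); rewrite !revK.
by have := congr1 (pmap lf) E; rewrite !pmap_cat !lfl !lfr.
Qed.

Lemma analytic_wordP (w : word g) : analytic_word w -> exists s, w = xword s.
Proof.
move=> wA; pose lf (a : letter g) := if a is inl j then Some j else None.
exists (pmap lf w); apply: word_inj => /=.
move: wA; rewrite /analytic_word; elim: (w : seq _) => [|a s IH] //= sA.
have [j ->] := sA a (mem_head _ _); rewrite /= -IH // => b bs.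
by apply: sA; rewrite inE bs orbT.
Qed.

Lemma hereditary_word_size (u : word g) : hereditary_word u -> (fdeg u <= d)%N ->
  exists v w, [/\ u = hereditary_of v w, (size v <= d)%N & (size w <= d)%N].
Proof.
move=> [v0 [w0 [/analytic_wordP[v ->] /analytic_wordP[w ->] ->]]] ud.
exists v, w; split=> //.
  by apply: leq_trans ud; rewrite fdegE hereditary_ofE size_cat !size_map size_rev leq_addr.
by apply: leq_trans ud; rewrite fdegE hereditary_ofE size_cat !size_map leq_addl.
Qed.

Lemma coefmx_hpoly (H : 'M[C]_(nidx g nu d)) s t u :
  (hpoly H s t)@_u = \sum_a \sum_b
    H a b *+ [&& idx_col a == s, idx_col b == t & hereditary_of (idx_word a) (idx_word b) == u].
Proof.
rewrite mxE raddf_sum exchange_big; apply: eq_bigr => b _ /=.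
rewrite mxE mulr_suml raddf_sum; apply: eq_bigr => a _ /=.
rewrite !mxE starU !mulUU mcoeffU -/(hereditary_of _ _) mulm1.
case: (idx_col a == s); rewrite ?mul1r ?mulr1 ?conjC1 /=; last first.
  by rewrite rmorph0 !mul0r mul0rn.
rewrite mul1r; case: (idx_col b == t) => /=; rewrite ?mulr1 ?mulr0 //.
by rewrite mul0rn.
Qed.

(** The total degree bounds the lengths of both halves of each word, and each word
    in the support comes from exactly one pair of indices. *)
Lemma hereditary_hpoly (h : 'M[P]_nu) : hereditary h -> (degmx h <= d)%N ->
  exists H : 'M[C]_(nidx g nu d), h = hpoly H.
Proof.
move=> hH hd.
exists (\matrix_(a, b)
  mcoeff (hereditary_of (idx_word a) (idx_word b)) (h (idx_col a) (idx_col b))).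
apply/matrixP => s t; apply/malgP => u; rewrite coefmx_hpoly.
have [[v [w [-> vd wd']]]|uN] :=
  pselect (exists v w, [/\ u = hereditary_of v w, (size v <= d)%N & (size w <= d)%N]).
  rewrite (bigD1 (mkidx d v s)) //= (bigD1 (mkidx d w t)) //= mxE.
  rewrite !idx_col_mkidx !idx_word_mkidx // !eqxx mulr1n big1 ?addr0 => [|b bN].
    rewrite big1 ?addr0 // => a aN; apply: big1 => b _.
    case: and3P => [[/eqP as_ /eqP bt /eqP/hereditary_of_inj[va wb]]|]; last by rewrite mulr0n.
    by rewrite -va -as_ mkidxK eqxx in aN.
  case: and3P => [[/eqP as_ /eqP bt /eqP/hereditary_of_inj[va wb]]|]; last by rewrite mulr0n.
  by rewrite -wb -bt mkidxK eqxx in bN.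
have -> : (h s t)@_u = 0.
  apply: mcoeff_outdom; apply/negP => us; apply: uN.
  have uS : u \in suppmx h by apply/bigfcupP; exists (s, t); rewrite ?mem_index_enum.
  apply: hereditary_word_size (hH _ uS) _; apply: leq_trans hd.
  by rewrite /degmx; apply: (@leq_bigmax_seq _ _ xpredT).
rewrite big1 // => a _; apply: big1 => b _.
case: and3P => [[_ _ /eqP ab]|]; last by rewrite mulr0n.
by case: uN; exists (idx_word a), (idx_word b); rewrite ab !size_idx_word.
Qed.
End Hereditary.

(** * Degrees of analytic polynomials *)

Section Degree.
Variables (C : numClosedFieldType) (g : nat).
Local Notation P := (ncpoly C g).

Lemma suppmxP a b (p : 'M[P]_(a, b)) w :
  reflect (exists i j, (p i j)@_w != 0) (w \in suppmx p).
Proof.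
apply: (iffP (bigfcupP _ _ _ _)) => [[[i j] _ wp]|[i [j wp]]].
  by exists i, j; rewrite mcoeff_neq0.
by exists (i, j); rewrite ?mem_index_enum // -mcoeff_neq0.
Qed.

Lemma analytic_deg_leP a b m (p : 'M[P]_(a, b)) :
  analytic_deg_le m p <->
  (forall w, w \in suppmx p -> analytic_word w /\ (fdeg w <= m)%N).
Proof.
split=> [[pA pm] w wp|H].
  split; first exact: pA.
  by apply: leq_trans pm; rewrite /degmx; apply: (@leq_bigmax_seq _ _ xpredT).
split=> [w /H[]//|]; apply/bigmax_leqP_seq => w wp _.
by case: (H w wp).
Qed.

Lemma analytic_deg_le_cstmx a b c m (V : 'M[C]_(a, b)) (p : 'M[P]_(b, c)) :
  analytic_deg_le m p -> analytic_deg_le m (cstmx g V *m p).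
Proof.
move=> /analytic_deg_leP H; apply/analytic_deg_leP => w /suppmxP[i [j wp]].
apply: H; apply/suppmxP.
have /existsP[k kp] : [exists k, (p k j)@_w != 0].
  apply: contraNT wp => /existsPn H; rewrite mxE raddf_sum big1 // => k _.
  rewrite mxE /= mcoeffCM; have := H k; rewrite negbK => /eqP ->.
  by rewrite mulr0.
by exists k, j.
Qed.

Lemma analytic_deg_le_monomials nu D : analytic_deg_le D (monomials C g nu D).
Proof.
apply/analytic_deg_leP => w /suppmxP[a [t]].
rewrite mxE mcoeffU; case: (xword (idx_word a) =P w) => [<- _|]; last by rewrite mulr0n eqxx.
split=> [x|]; first by rewrite /xword /= => /mapP[j _ ->]; exists j.
by rewrite fdegE /= size_map size_idx_word.
Qed.

Lemma analytic_deg_leW a b m m' (p : 'M[P]_(a, b)) : (m <= m')%N ->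
  analytic_deg_le m p -> analytic_deg_le m' p.
Proof. by move=> mm [pA pm]; split=> //; exact: leq_trans mm. Qed.
End Degree.

(** * Bounded spectrahedra *)

Section Bounded.
Variables (R : realType) (g l : nat).
Local Notation C := (complex R).
Local Notation re := (@complex.Re R).
Variable A : 'I_g -> 'M[C]_l.

Lemma euclnorm1 (v : 'cV[C]_1) : euclnorm v = ComplexField.Normc.normc (v 0 0).
Proof.
rewrite /euclnorm big_ord1 sqrtr_sqr ger0_norm //.
by case: (v 0 0) => x y; rewrite sqrtr_ge0.
Qed.

Lemma opnorm_scalar (c : C) :
  ComplexField.Normc.normc c <= opnorm (c%:M : 'M[C]_1).
Proof.
have nM := @ComplexField.Normc.normcM R.
apply: ub_le_sup.
  exists (ComplexField.Normc.normc c) => _ [v /= v1 <-].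
  rewrite mul_scalar_mx !euclnorm1 mxE nM in v1 *.
  rewrite -[leRHS]mulr1; apply: ler_wpM2l => //.
  by case: (c) => x y; rewrite sqrtr_ge0.
exists 1%:M; last by rewrite mulmx1 euclnorm1 mxE eqxx mulr1n.
by rewrite /= euclnorm1 mxE eqxx mulr1n /= expr0n /= addr0 expr1n sqrtr1.
Qed.

(** The coefficients of the pencil, with [None] for its constant term. *)
Definition coef_mx (k : option 'I_g) : 'M[C]_l := if k is Some j then A j else 1%:M.

Definition coef_form (k : option 'I_g) (z u : 'rV[C]_l) : C :=
  \tr (coef_mx k *m u^T *m (z^T)^t*).

Lemma coef_form_sesqui k : sesquilinear (coef_form k).
Proof.
split=> a z z' u; rewrite /coef_form.
  by rewrite linearP /= adjmxD adjmxZ mulmxDr -scalemxAr mxtraceD mxtraceZ.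
by rewrite linearP /= mulmxDr -scalemxAr mulmxDl -scalemxAl mxtraceD mxtraceZ.
Qed.

Lemma coef_form_None (z : 'rV[C]_l) : coef_form None z z = (\sum_i nsq (z 0 i))%:C%C.
Proof.
rewrite /coef_form mul1mx rmorph_sum; apply: eq_bigr => i _.
by rewrite mxE big_ord1 adjmxE !mxE -normCK normsqE.
Qed.

Lemma twice_re (x : C) : x + x^* = (re x *+ 2)%:C%C.
Proof. by case: x => a b; apply/eqP; rewrite eq_complex /= subrr mulr2n !eqxx. Qed.

Lemma scalar_in_spectrahedron (y : 'I_g -> C) :
  (forall z : 'rV[C]_l,
     0 <= (\sum_i nsq (z 0 i)) + re (\sum_j y j * coef_form (Some j) z z) *+ 2) ->
  free_spectrahedron A (fun j => (y j)%:M : 'M[C]_1).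
Proof.
move=> ypos; rewrite /free_spectrahedron /=.
split; first exact: evalmx_pencil_herm.
move=> v; pose z := (untensvec v)^T.
have zE : z^T = untensvec v by rewrite trmxK.
rewrite (_ : _ 0 0 = ((\sum_i nsq (z 0 i))
    + re (\sum_j y j * coef_form (Some j) z z) *+ 2)%:C%C); first by rewrite lecR.
rewrite pencil_quad -zE rmorphD /= -coef_form_None -twice_re -addrA.
have E0 : \tr (z^T *m (z^T)^t*) = coef_form None z z by rewrite /coef_form /= (mul1mx z^T).
have term j : \tr (A j *m z^T *m ((y j)%:M : 'M[C]_1)^T *m (z^T)^t*)
    = y j * coef_form (Some j) z z.
  by rewrite tr_scalar_mx mul_mx_scalar -scalemxAl mxtraceZ.
have E1 : \sum_j \tr (A j *m z^T *m ((y j)%:M : 'M[C]_1)^T *m (z^T)^t*)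
    = \sum_j y j * coef_form (Some j) z z by apply: eq_bigr => j _; exact: term.
have E2 : \sum_j \tr ((A j)^t* *m z^T *m (((y j)%:M : 'M[C]_1)^t*)^T *m (z^T)^t*)
    = (\sum_j y j * coef_form (Some j) z z)^*.
  rewrite rmorph_sum; apply: eq_bigr => j _ /=; rewrite -term.
  have -> : (((y j)%:M : 'M[C]_1)^t*)^T = (((y j)%:M : 'M[C]_1)^T)^t* by rewrite map_trmx.
  exact: cross_adj.
by apply: (congr2 (fun a b => a + b)) E0 _; apply: (congr2 (fun a b => a + b)) E1 E2.
Qed.

(** Duality for the positive semidefinite matrices rho with tr (A_j rho) = 0 and
    tr rho = 1.  If there is one, its vectors, placed in each column in turn, give
    the V.  If not, the separating functional is a tuple y of scalars such that
    the real part of [sum_j y_j A_j] is positive definite; then t y lies in D_A for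
    all t >= 0, which is impossible unless y = 0. *)
Lemma bounded_identity : (0 < l)%N -> free_bounded A ->
  exists Vs : seq 'M[C]_l, \sum_(V <- Vs) V^t* *m V = 1%:M /\
    forall j, \sum_(V <- Vs) V^t* *m A j *m V = 0.
Proof.
move=> l_gt0 [N bdN].
have [|//||[B Bb]|[y [ypos yneg]]] :=
  @sesqui_farkas R (option 'I_g) l coef_form (fun k => (k == None)%:R)
    (fun k => (k == None)%:R) 1.
- exact: coef_form_sesqui.
- move=> z; rewrite (bigD1 None) //= [X in _ + X]big1 ?addr0; last first.
    by move=> [j|] //= _; rewrite mul0r.
  by rewrite coef_form_None !mul1r.
- pose w r := (row r B)^T.
  pose V (ri : 'I_l.+1 * 'I_l) : 'M[C]_l := w ri.1 *m delta_mx 0 ri.2.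
  have key k : \sum_(X <- [seq V ri | ri <- enum (predT : pred ('I_l.+1 * 'I_l))])
      X^t* *m coef_mx k *m X = ((k == None)%:R : C)%:M.
    rewrite big_map big_enum /= -(Bb k).
    transitivity (\sum_r \sum_i (V (r, i))^t* *m coef_mx k *m V (r, i)).
      by rewrite pair_big; apply: eq_bigr => -[].
    rewrite /gram rmorph_sum /=; apply: eq_bigr => r _.
    have wE : (w r)^t* *m coef_mx k *m w r = (coef_form k (row r B) (row r B))%:M.
      by rewrite [LHS]mx11_scalar /coef_form -mxtrace_mulC mulmxA /mxtrace big_ord1.
    transitivity (\sum_i coef_form k (row r B) (row r B) *: (delta_mx i i : 'M[C]_l)).
      apply: eq_bigr => i _; rewrite /V /= adjmxM.
      have -> : (delta_mx 0 i : 'rV[C]_l)^t* = delta_mx i 0.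
        by rewrite trmx_delta; apply/matrixP => a b; rewrite !mxE rmorph_nat.
      rewrite !mulmxA -(mulmxA (delta_mx i 0)) -(mulmxA (delta_mx i 0)) wE.
      by rewrite mul_mx_scalar -scalemxAl mul_delta_mx.
    by rewrite -scaler_sumr -[RHS]scalemx1 mx1_sum_delta.
  exists [seq V ri | ri <- enum (predT : pred ('I_l.+1 * 'I_l))]; split.
    rewrite -[RHS](key None); apply: eq_bigr => X _.
    by rewrite /= mulmx1.
  by move=> j; have := key (Some j); rewrite /= raddf0.
exfalso.
pose y' j := y (Some j).
have yneg0 : re (y None) < 0.
  move: yneg; rewrite (bigD1 None) //= big1 ?addr0 ?mulr1 // => -[j|] //.
  by rewrite mulr0.
have ineq (z : 'rV[C]_l) :
    0 <= re (\sum_j y' j * coef_form (Some j) z z) + re (y None) * (\sum_i nsq (z 0 i)).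
  have := ypos z; rewrite (bigD1 None) //= coef_form_None reD addrC mulrC reZ.
  rewrite (reindex_omap Some id) /=; last by case.
  rewrite (eq_bigl xpredT) => [|j]; last by rewrite eqxx.
  by rewrite [X in _ + X]mulrC.
have in_dom t : 0 <= t -> free_spectrahedron A (fun j => (t%:C%C * y' j)%:M : 'M[C]_1).
  move=> t0; apply: scalar_in_spectrahedron => z.
  under [X in re X]eq_bigr do rewrite -mulrA; rewrite -mulr_sumr reZ.
  have N0 : 0 <= \sum_i nsq (z 0 i) by apply: sumr_ge0 => i _; exact: nsq_ge0.
  rewrite addr_ge0 // mulrn_wge0 // mulr_ge0 //.
  have := ineq z; rewrite -(lerBlDr) sub0r; apply: le_trans.
  by rewrite oppr_ge0 nmulr_rle0.
have y0 j : y' j = 0.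
  pose c := ComplexField.Normc.normc (y' j).
  have c0 : 0 <= c by rewrite /c; case: (y' j) => a b; rewrite sqrtr_ge0.
  apply/ComplexField.Normc.eq0_normc/eqP; rewrite -/c.
  apply: contraT; rewrite neq_lt ltNge c0 /= => c_gt0.
  pose t := (`|N| + 1) / c.
  have t0 : 0 <= t by rewrite divr_ge0 // addr_ge0.
  have : tuplenorm (fun j => (t%:C%C * y' j)%:M : 'M[C]_1) <= N by apply/bdN/in_dom.
  have : `|N| + 1 <= tuplenorm (fun j => (t%:C%C * y' j)%:M : 'M[C]_1).
    apply: le_trans (le_bigmax _ _ j); apply: le_trans (opnorm_scalar _).
    rewrite ComplexField.Normc.normcM /= expr0n addr0 sqrtr_sqr (ger0_norm t0).
    by rewrite -/c /t divfK // gt_eqF.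
  move=> /le_trans H /H; have := ler_norm N; lra.
have := ineq (delta_mx 0 (Ordinal l_gt0)).
rewrite big1 => [|j _]; last by rewrite y0 mul0r.
rewrite (bigD1 (Ordinal l_gt0)) //= big1 => [|i /negPf iN]; last first.
  by rewrite mxE iN /nsq /= expr0n addr0.
rewrite mxE !eqxx /nsq /= expr0n expr1n /= !addr0 add0r mulr1.
by rewrite leNgt yneg0.
Qed.
End Bounded.

(** * The characterization *)

Section Assembly.
Variables (R : realType) (g l nu : nat).
Local Notation C := (complex R).
Local Notation P := (ncpoly C g).
Variable A : 'I_g -> 'M[C]_l.

Lemma pencil_congr m (V : 'M[C]_(l, m)) :
  starmx (cstmx g V) *m pencil A *m cstmx g V = cstmx g (V^t* *m V)
  + \sum_j (varmx C _ (inl j) *m cstmx g (V^t* *m A j *m V)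
          + varmx C _ (inr j) *m cstmx g (V^t* *m (A j)^t* *m V)).
Proof.
rewrite pencilE mulmxDr mulmxDl mulmx1 starmx_cstmx -cstmxM; congr (_ + _).
rewrite mulmx_sumr mulmx_suml; apply: eq_bigr => j _.
rewrite mulmxDr mulmxDl; congr (_ + _).
  by rewrite mulmxA cstmx_varmx cstmxM cstmxM !mulmxA.
by rewrite mulmxA cstmx_varmx cstmxM cstmxM !mulmxA.
Qed.

Lemma bounded_one : (0 < l)%N -> free_bounded A ->
  exists Vs : seq 'M[C]_l,
    \sum_(V <- Vs) starmx (cstmx g V) *m pencil A *m cstmx g V = 1%:M.
Proof.
move=> l0 bA; have [Vs [V1 VA]] := bounded_identity l0 bA; exists Vs.
under eq_bigr do rewrite pencil_congr.
rewrite big_split /= -cstmx_sum V1 exchange_big /= big1 ?addr0.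
  exact: (map_mx1 (@malgC (word g) C : {rmorphism C -> P})).
have sum_var (a : letter g) (F : 'M[C]_l -> 'M[C]_l) : \sum_(V <- Vs) F V = 0 ->
    \sum_(V <- Vs) varmx C l a *m cstmx g (F V) = 0.
  by move=> F0; rewrite -mulmx_sumr -cstmx_sum F0 cstmx0 mulmx0.
move=> j _.
have VA' : \sum_(V <- Vs) V^t* *m (A j)^t* *m V = 0.
  have := congr1 (fun M : 'M[C]_l => M^t*) (VA j); rewrite /= adjmx_sum adjmx0.
  by apply: etrans; apply: eq_bigr => V _; rewrite adjmxM adjmxM trmxCK mulmxA.
rewrite big_split /=.
exact: etrans (congr2 +%R (sum_var (inl j) (fun V => V^t* *m A j *m V) (VA j))
  (sum_var (inr j) (fun V => V^t* *m (A j)^t* *m V) VA')) (addr0 _).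
Qed.

(** Insert the identity 1 = sum V^* L_A V in the middle of each square. *)
Lemma absorb_squares (Vs : seq 'M[C]_l) (hs fs : seq 'M[P]_(l, nu)) :
  \sum_(V <- Vs) starmx (cstmx g V) *m pencil A *m cstmx g V = 1%:M ->
  \sum_(p <- hs) (starmx p *m p) + \sum_(f <- fs) (starmx f *m pencil A *m f)
  = \sum_(f <- [seq cstmx g V *m p | p <- hs, V <- Vs] ++ fs)
      (starmx f *m pencil A *m f).
Proof.
move=> V1.
have sq p : starmx p *m p =
    \sum_(V <- Vs) starmx (cstmx g V *m p) *m pencil A *m (cstmx g V *m p).
  transitivity (starmx p *m ((\sum_(V <- Vs)
      starmx (cstmx g V) *m pencil A *m cstmx g V) *m p)); first by rewrite V1 mul1mx.
  rewrite mulmx_suml mulmx_sumr; apply: eq_bigr => V _.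
  by rewrite starmxM; exact: mulmx_regroup.
rewrite big_cat.
apply: (congr1 (fun q => q + \sum_(f <- fs) starmx f *m pencil A *m f)).
by rewrite big_allpairs_dep; apply: eq_bigr => p _; exact: sq.
Qed.

Lemma certificate_polys d (H : 'M[C]_(nidx g nu d)) : certificate A H ->
  exists hs fs : seq 'M[P]_(l, nu),
    [/\ (forall p, p \in hs -> analytic_deg_le d.+1 p),
        (forall f, f \in fs -> analytic_deg_le d f)
      & hpoly H = \sum_(p <- hs) (starmx p *m p)
          + \sum_(f <- fs) (starmx f *m pencil A *m f)].
Proof.
move=> [B HB].
exists [seq cstmx g (square_part (row r B)) *m monomials C g nu d.+1 | r <- index_enum _].
exists [seq cstmx g (pencil_part (row r B)) *m monomials C g nu d | r <- index_enum _]; split.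
- by move=> _ /mapP[z _ ->]; exact/analytic_deg_le_cstmx/analytic_deg_le_monomials.
- by move=> _ /mapP[z _ ->]; exact/analytic_deg_le_cstmx/analytic_deg_le_monomials.
rewrite -hpoly_widen HB hpoly_sum 2!big_map -big_split /=.
apply: eq_bigr => r _.
by rewrite /cert_form hpolyD square_hpoly pencil_hpoly.
Qed.
End Assembly.

Theorem theorem1p11 (R : realType) (g l nu d : nat)
    (A : 'I_g -> 'M[complex R]_l) (h : 'M[ncpoly (complex R) g]_nu)
    (l_gt0 : (0 < l)%N) (h_hereditary : hereditary h) (h_deg : degmx h = d) :
  (psd_on_spectrahedron A h <->
     exists hs fs : seq 'M[ncpoly (complex R) g]_(l, nu),
       [/\ (forall p, p \in hs -> analytic_deg_le d.+1 p),
           (forall f, f \in fs -> analytic_deg_le d f)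
         & h = \sum_(p <- hs) (starmx p *m p)
             + \sum_(f <- fs) (starmx f *m pencil A *m f)]) /\
  (free_bounded A ->
     (psd_on_spectrahedron A h <->
        exists fs : seq 'M[ncpoly (complex R) g]_(l, nu),
          (forall f, f \in fs -> analytic_deg_le d.+1 f) /\
          h = \sum_(f <- fs) (starmx f *m pencil A *m f))).
Proof.
have cert : psd_on_spectrahedron A h ->
  exists hs fs : seq 'M[ncpoly (complex R) g]_(l, nu),
    [/\ (forall p, p \in hs -> analytic_deg_le d.+1 p),
        (forall f, f \in fs -> analytic_deg_le d f)
      & h = \sum_(p <- hs) (starmx p *m p)
          + \sum_(f <- fs) (starmx f *m pencil A *m f)].
  have [|H ->] := hereditary_hpoly (d := d) h_hereditary; first by rewrite h_deg.
  by move=> /(psd_certificate l_gt0)/certificate_polys.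
split.
  by split=> // -[hs [fs [_ _ ->]]]; exact: psd_of_certificate.
move=> bA; split=> [/cert[hs [fs [hs_deg fs_deg ->]]]|[fs [_ ->]]]; last first.
  exact: psd_of_pencil_certificate.
have [Vs V1] := bounded_one l_gt0 bA.
exists ([seq cstmx g V *m p | p <- hs, V <- Vs] ++ fs); split; last exact: absorb_squares.
move=> f; rewrite mem_cat => /orP[/allpairsP[[p V] /= [php _ ->]]|/fs_deg].
  exact/analytic_deg_le_cstmx/hs_deg.
exact: analytic_deg_leW.
Qed.
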